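(* For all $n \geq 3$, there is a countable discrete subgroup $\Gamma < \mathrm{SL}(n,\mathbb{R})$ such that the linear action $\Gamma \curvearrowright \mathbb{R}^n$ is ergodic while the dual action $\Gamma^T \curvearrowright \mathbb{R}^n$ is non-ergodic.
   Context: For $\Gamma < \mathrm{GL}(n,\mathbb{R})$, $\Gamma^T$ denotes the image of $\Gamma$ under the automorphism $A \mapsto (A^T)^{-1}$ of $\mathrm{GL}(n,\mathbb{R})$; it acts linearly on $\mathbb{R}^n$. (Under the usual identification of the Pontryagin dual $\widehat{\mathbb{R}^n}$ with $\mathbb{R}^n$, this is the dual of the linear action of $\Gamma$.) Ergodicity is with respect to Lebesgue measure: every invariant Borel set is null or conull. *)

(* Defs.v *)
From HB Require Import structures.
From mathcomp Require Import all_boot all_order all_algebra.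
From mathcomp Require Import all_classical all_reals all_analysis.
From mathcomp Require Import measurable_realfun.

Set Implicit Arguments.
Unset Strict Implicit.
Unset Printing Implicit Defensive.

Import Order.TTheory GRing.Theory Num.Theory.
Import numFieldNormedType.Exports.

Local Open Scope classical_set_scope.
Local Open Scope ring_scope.

(* R^n, seen as column vectors, with its Borel sigma-algebra *)
Notation borel_cV R n := (g_sigma_algebraType (@open 'cV[R]_n)).

Definition cV_cons (R : realType) (n : nat)
    (p : measurableTypeR R * borel_cV R n) : borel_cV R n.+1 :=
  col_mx (p.1%:M : 'cV[R]_1) (p.2 : 'cV[R]_n).

Lemma cV_consP (R : realType) (n : nat) (p : R * 'cV[R]_n) :
  (cV_cons p : 'cV[R]_n.+1) ord0 ord0 = p.1 /\
  forall i, (cV_cons p : 'cV[R]_n.+1) (lift ord0 i) ord0 = p.2 i ord0.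
Proof.
split=> [|i].
  have -> : ord0 = lshift n (ord0 : 'I_1) :> 'I_n.+1 by exact: val_inj.
  by apply: etrans (col_mxEu _ _ _ _) _; rewrite mxE mulr1n.
have -> : lift ord0 i = rshift 1 i :> 'I_n.+1 by exact: val_inj.
exact: (col_mxEd (p.1%:M : 'cV[R]_1) p.2).
Qed.

Lemma measurable_cV_cons (R : realType) (n : nat) :
  measurable_fun [set: measurableTypeR R * borel_cV R n] (@cV_cons R n).
Proof.
apply: (@measurability _ _ _ (borel_cV R n.+1) _ _ open) => //.
move=> _ [U oU <-]; rewrite setTI.
pose B (t : (rat * 'cV[rat]_n) * nat) : set (R * 'cV[R]_n) :=
  ball (ratr t.1.1 : R) t.2.+1%:R^-1 `*`
  ball (map_mx ratr t.1.2 : 'cV[R]_n) t.2.+1%:R^-1.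
have -> : @cV_cons R n @^-1` U =
    \bigcup_t (if pselect (B t `<=` @cV_cons R n @^-1` U) then B t else set0).
  apply/seteqP; split=> [[x v] Uxv|p [t _]]; last first.
    by case: pselect => [BU|_ []]; exact: BU.
  have /nbhs_ballP[e /= e0 eU] : nbhs (cV_cons (x, v) : 'cV[R]_n.+1) U.
    exact: open_nbhs_nbhs.
  have [k ke] : exists k : nat, k.+1%:R^-1 < e / 2.
    have e20 : 0 < e / 2 by rewrite divr_gt0.
    have [k _ /(_ k (leqnn k))] := near_infty_natSinv_lt (PosNum e20).
    by exists k.
  have k0 : (0 : R) < k.+1%:R^-1 by rewrite invr_gt0.
  have rat_near (y : R) : exists q : rat, `|ratr q - y| < k.+1%:R^-1.
    have [|q] := @rat_in_itvoo R (y - k.+1%:R^-1) (y + k.+1%:R^-1).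
      by rewrite ltrBlDr -addrA ltrDl addr_gt0.
    by move=> /itvP qy; exists q; rewrite ltr_distl !qy.
  have [q qx] := rat_near x.
  have [w wv] := choice (fun i => rat_near (v i ord0)).
  exists ((q, \col_i w i), k) => //; case: pselect => [BU|/=].
    split=> /=; first by rewrite /ball /=.
    by split=> // i j; rewrite !mxE ord1 /ball /=; exact: wv.
  case=> -[x' v'] [/= qx' [_ wv']]; apply: eU; split=> // i j; rewrite ord1 {j}.
  have [c0 cS] := cV_consP (x, v); have [c0' cS'] := cV_consP (x', v').
  have main (a b c : R) : `|c - a| < k.+1%:R^-1 -> `|c - b| < k.+1%:R^-1 ->
      `|a - b| < e.
    move=> ca cb; rewrite (_ : a - b = (c - b) - (c - a)); last first.
      by rewrite opprB [RHS]addrC addrA subrK.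
    rewrite (le_lt_trans (ler_normB _ _))// (splitr e) ltrD//.
      exact: lt_trans cb ke.
    exact: lt_trans ca ke.
  case: (unliftP ord0 i) => [j ->|->]; rewrite /ball /=.
    rewrite cS cS'; apply: (main _ _ _ (wv j)).
    by have := wv' j ord0; rewrite !mxE.
  by rewrite c0 c0'; exact: (main _ _ _ qx).
apply: countable_bigcupT_measurable => // t; case: pselect => BU; last exact: measurable0.
apply: measurableX; first by apply: open_measurable; exact: ball_open.
by apply: sub_sigma_algebra; exact: ball_open.
Qed.

Definition cV_uncons (R : realType) (n : nat) (v : borel_cV R n.+1) :
    measurableTypeR R * borel_cV R n :=
  ((v : 'cV[R]_n.+1) ord0 ord0, \col_i (v : 'cV[R]_n.+1) (lift ord0 i) ord0).

Lemma cV_consK (R : realType) (n : nat) :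
  cancel (@cV_cons R n) (@cV_uncons R n).
Proof.
move=> p; have [p1 p2] := cV_consP p; rewrite /cV_uncons p1.
rewrite [RHS]surjective_pairing; congr (_, _); apply/matrixP => i j.
by rewrite mxE p2 (ord1 j).
Qed.

Lemma measurable_cV_uncons (R : realType) (n : nat) :
  measurable_fun [set: borel_cV R n.+1] (@cV_uncons R n).
Proof.
have openB (T : pseudoMetricType R) (f : 'cV[R]_n.+1 -> T) (U : set T) :
    (forall v w e, ball v e w -> ball (f v) e (f w)) ->
    open U -> open (f @^-1` U).
  move=> fB; rewrite !openE => oU v /oU /nbhs_ballP[e /= e0 eU].
  by apply/nbhs_ballP; exists e => //= w /fB /eU.
apply: measurable_fun_pair.
  apply: (measurability _ (RGenOpens.measurableE R)).
  move=> _ [_ [a [b ->]] <-]; rewrite setTI.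
  apply: sub_sigma_algebra; apply: openB; last exact: interval_open.
  by move=> v w e [_]; exact.
apply: (@measurability _ _ _ (borel_cV R n) _ _ open) => //.
move=> _ [U oU <-]; rewrite setTI; apply: sub_sigma_algebra.
apply: (@openB 'cV[R]_n _ U) => // v w e [e0 vw]; split=> // i j.
by rewrite !mxE; exact: vw.
Qed.

Section lebesgue_cons.
Local Open Scope ereal_scope.
Context (R : realType) (n : nat).
Variable mu : {sigma_finite_measure set (borel_cV R n) -> \bar R}.

Definition lebesgue_cons : set (borel_cV R n.+1) -> \bar R :=
  pushforward (@lebesgue_measure R \x mu) (@cV_cons R n).

Let mcons A : measurable A -> measurable (@cV_cons R n @^-1` A).
Proof. by move=> mA; rewrite -[X in measurable X]setTI; exact: measurable_cV_cons. Qed.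

Let lebesgue_cons0 : lebesgue_cons set0 = 0.
Proof. by rewrite /lebesgue_cons /pushforward preimage_set0 measure0. Qed.

Let lebesgue_cons_ge0 A : 0 <= lebesgue_cons A.
Proof. by rewrite /lebesgue_cons /pushforward; apply: measure_ge0. Qed.

Let lebesgue_cons_sigma_additive : semi_sigma_additive lebesgue_cons.
Proof.
move=> F mF tF mUF; rewrite /lebesgue_cons /pushforward preimage_bigcup.
apply: measure_semi_sigma_additive.
- by move=> k; exact: mcons.
- apply/trivIsetP => i j _ _ ij; rewrite -preimage_setI.
  by move/trivIsetP : tF => ->//; rewrite preimage_set0.
- by rewrite -preimage_bigcup; exact: mcons.
Qed.

HB.instance Definition _ := isMeasure.Build _ _ _ lebesgue_cons
  lebesgue_cons0 lebesgue_cons_ge0 lebesgue_cons_sigma_additive.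

Lemma lebesgue_consX A B : measurable A -> measurable B ->
  lebesgue_cons (@cV_uncons R n @^-1` (A `*` B)) = lebesgue_measure A * mu B.
Proof.
move=> mA mB; rewrite -(product_measure1E _ _ mA mB) /lebesgue_cons /pushforward.
rewrite -comp_preimage (_ : _ \o _ = id) ?preimage_id//.
by apply/funext => p /=; exact: cV_consK.
Qed.

Let lebesgue_cons_sigma_finite : sigma_finite setT lebesgue_cons.
Proof.
have /sigma_finiteP[F [TF ndF Foo]] := sigma_finiteT (@lebesgue_measure R).
have /sigma_finiteP[G [TG ndG Goo]] := sigma_finiteT mu.
exists (fun k => @cV_uncons R n @^-1` (F k `*` G k)).
  rewrite -preimage_bigcup (_ : \bigcup_k _ = setT) ?preimage_setT//.
  rewrite -setXTT TF TG; apply/seteqP; split=> [|[x y]].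
    by move=> [x y] [k _ []/= ? ?]; split; exists k.
  move=> [/= [k _ Fx] [l _ Gy]]; exists (maxn k l) => //; split.
    by move: x Fx; exact/subsetPset/ndF/leq_maxl.
  by move: y Gy; exact/subsetPset/ndG/leq_maxr.
move=> k; have [mF Fk] := Foo k; have [mG Gk] := Goo k; split.
  rewrite -[X in measurable X]setTI; apply: measurable_cV_uncons => //.
  exact: measurableX.
by rewrite lebesgue_consX// lte_mul_pinfty// ge0_fin_numE.
Qed.

HB.instance Definition _ := Measure_isSigmaFinite.Build _ _ _ lebesgue_cons
  lebesgue_cons_sigma_finite.

End lebesgue_cons.

(* Lebesgue measure on R^n: the n-fold product of the Lebesgue measure on R,
   a point mass when n = 0.  See lebesgue_cV_box for its values on boxes. *)
Fixpoint lebesgue_cV (R : realType) (n : nat) :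
    {sigma_finite_measure set (borel_cV R n) -> \bar R} :=
  match n with
  | 0 => @dirac _ (borel_cV R 0) (0 : 'cV[R]_0) R
  | m.+1 => lebesgue_cons (lebesgue_cV R m)
  end.

Definition cV_box (R : realType) (n : nat) (a b : 'cV[R]_n) :
    set (borel_cV R n) :=
  [set x : 'cV[R]_n | forall i, a i ord0 <= x i ord0 <= b i ord0].

Lemma cV_box_cons (R : realType) (n : nat) (a b : 'cV[R]_n.+1) :
  cV_box a b = @cV_uncons R n @^-1` (`[a ord0 ord0, b ord0 ord0] `*`
    cV_box (\col_i a (lift ord0 i) ord0) (\col_i b (lift ord0 i) ord0)).
Proof.
apply/seteqP; split=> [x xab|x []/= + x'ab i].
  by split=> [/=|i]; [rewrite in_itv/= xab|rewrite !mxE xab].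
rewrite in_itv/= => x0ab; case: (unliftP ord0 i) => [j ->|->//].
by have := x'ab j; rewrite !mxE.
Qed.

Lemma measurable_cV_box (R : realType) (n : nat) (a b : 'cV[R]_n) :
  measurable (cV_box a b).
Proof.
elim: n a b => [|n IHn] a b.
  rewrite (_ : cV_box a b = setT)//; apply/seteqP; split=> // x _ [].
  by [].
rewrite cV_box_cons -[X in measurable X]setTI.
by apply: measurable_cV_uncons => //; exact: measurableX.
Qed.

Lemma lebesgue_cV_box (R : realType) (n : nat) (a b : 'cV[R]_n) :
  (forall i, a i ord0 <= b i ord0) ->
  lebesgue_cV R n (cV_box a b) = (\prod_(i < n) (b i ord0 - a i ord0))%:E.
Proof.
elim: n a b => [|n IHn] a b ab.
  by rewrite big_ord0 /= diracE mem_set// => -[].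
rewrite big_ord_recl EFinM cV_box_cons [LHS]lebesgue_consX//; last first.
  exact: measurable_cV_box.
rewrite lebesgue_measure_itv/= lte_fin IHn; last by move=> i; rewrite !mxE.
congr (_ * _)%E.
  by case: ltgtP (ab ord0) => // -> _; rewrite subrr.
by congr EFin; apply: eq_bigr => i _; rewrite !mxE.
Qed.

Definition is_subgroup_SL (R : realType) (n : nat) (G : set 'M[R]_n) : Prop :=
  [/\ G `<=` [set g | \det g = 1],
      G 1%:M,
      forall g h, G g -> G h -> G (g *m h) &
      forall g, G g -> G (invmx g)].

(* Discreteness in the subspace topology: every point of A is isolated in A *)
Definition discrete_subset (T : topologicalType) (A : set T) : Prop :=
  A `<=` isolated A.

Definition dual_group (R : realType) (n : nat) (G : set 'M[R]_n) :
    set 'M[R]_n :=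
  [set invmx g^T | g in G].

(* G is meant to be a group acting on R^n by left multiplication, so that
   invariance of A can be stated as an equality of sets *)
Definition ergodic (R : realType) (n : nat) (G : set 'M[R]_n) : Prop :=
  forall A : set (borel_cV R n), measurable A ->
    (forall g, G g -> [set g *m x | x in (A : set 'cV[R]_n)] = A) ->
    lebesgue_cV R n A = 0%E \/ lebesgue_cV R n (~` A) = 0%E.

(* Main.v *)
Require Import Defs.
From HB Require Import structures.
From mathcomp Require Import all_boot all_order all_algebra.
From mathcomp Require Import all_classical all_reals all_analysis.
From mathcomp Require Import measurable_realfun ring lra zify.

(** The group is [affine_SLZ]: the matrices of SL(n, Z) that fix the first basis
    vector, that is the block matrices [(1, w; 0, h)] with [w] an integer row and
    [h] in SL(n - 1, Z). It is countable and discrete since its elements are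
    integer matrices. The matrices of the dual group preserve the first
    coordinate, so the half space where this coordinate is positive is invariant
    under the dual action ([dual_affine_SLZ_not_ergodic]).

    The group itself acts on [R x R^(n - 1)] by [(t, v) |-> (t + w v, h v)]. For
    almost every [v] the numbers [w v] are dense in [R], so that the slice over
    [v] of an invariant set is null or conull; the set of the [v] with a null slice
    is invariant under SL(n - 1, Z). Hence ergodicity follows from that of
    SL(n - 1, Z) on [R^(n - 1)] ([affine_SLZ_ergodic]). As SL(n, Z) contains the
    group, the same implication is an induction step for the ergodicity of
    SL(n, Z), and it remains to treat SL(2, Z) on the plane ([SL2Z_zero_one]).

    The proof given for SL(2, Z) is elementary. Let [A] be an invariant set, and
    use as coordinates the height [y] and the slope [t = x / y]. For coprime [c]
    and [k], the form [s = c x - k y] takes values in [`]0, sigma]`] on a thin strip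
    along the line of slope [k / c]. A matrix of SL(2, Z) maps this strip to the
    horizontal strip [0 < s <= sigma], on which [A] is periodic along each
    horizontal line, with period [s]. So when [c sigma] is small, the proportion
    of [A] in the part of the strip above a box is almost the proportion of [A] in
    the horizontal strip, which depends neither on the box nor on [(c, k)]
    ([strip_line_measure], [strip_integral_sum]).

    Take now all the strips with [c <= N], for [sigma = eps / N]. They are disjoint
    ([strip_sum_le]), and when [N] tends to infinity they equidistribute: the part
    of a Borel set that they cover is asymptotic to a fixed positive proportion of
    its measure for [dy dt] ([cvg_strip_discrepancy]). On intervals of slopes this
    is a count of coprime integers by Legendre's sieve, and it extends to Borel
    sets because the covered part never exceeds the whole. Apply this to the
    intersection of [A] and a box. Both it and the box are sampled faithfully by
    the strips, and in the strips the proportion of [A] does not depend on the box,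
    up to [O(eps)]. So the density of [A] is the same in all boxes
    ([slope_box_density]), and a set with constant density is null or conull. *)

Set Implicit Arguments.
Unset Strict Implicit.
Unset Printing Implicit Defensive.

Import Order.TTheory GRing.Theory Num.Theory.
Import numFieldNormedType.Exports.

Local Open Scope classical_set_scope.
Local Open Scope ring_scope.

(** * Counting integers coprime to [c] below a bound *)

(** The proportion [totient c / c] of integers coprime to [c]. *)
Definition coprime_ratio (R : realFieldType) (c : nat) : R :=
  \prod_(p <- primes c) (1 - p%:R^-1).

Definition coprime_count (c n : nat) : nat := \sum_(0 <= k < n) coprime k c.

(** The reindexing behind one step of the sieve: the multiples of [p] below [n]
    are the [p * j], and the number [m] of them exceeds [n / p] by less than 1. *)
Lemma sum_multiples (p n : nat) (P : pred nat) : (0 < p)%N ->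
  exists2 m, (n <= p * m < n + p)%N &
    (\sum_(0 <= k < n) ((p %| k) && P k) = \sum_(0 <= j < m) P (p * j))%N.
Proof.
move=> p0; elim: n => [|n [m mn E]].
  by exists 0%N; rewrite ?muln0 ?add0n ?p0// !big_geq.
rewrite big_nat_recr//= E.
have [/dvdnP[q qn]|pn] := boolP (p %| n)%N.
  have mq : m = q by nia.
  exists q.+1; first by nia.
  by rewrite big_nat_recr//= mq qn (mulnC q).
exists m; last by rewrite andFb addn0.
have pmn : (p * m != n)%N by apply: contra pn => /eqP <-; exact: dvdn_mulr.
by move: mn pmn; lia.
Qed.

(** The first bound is Weierstrass' product inequality. *)
Lemma prod_1subV_bounds (R : realFieldType) (ps : seq nat) :
  all prime ps ->
  1 - \sum_(p <- ps) (p%:R^-1 : R) <= \prod_(p <- ps) (1 - p%:R^-1 : R) /\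
  0 <= \prod_(p <- ps) (1 - p%:R^-1 : R) <= 1.
Proof.
elim: ps => [|p ps IH]; first by rewrite !big_nil subr0 ler01 lexx.
rewrite !big_cons/= => /andP[pp /IH[IH1 /andP[IH2 IH3]]].
have p0 : 0 < (p%:R : R)^-1 by rewrite invr_gt0 ltr0n prime_gt0.
have p1 : (p%:R : R)^-1 <= 1 by rewrite invf_le1 ?ltr0n ?ler1n prime_gt0.
move: IH1 IH2 IH3 p0 p1; set s := \sum_(_ <- _) _; set q := \prod_(_ <- _) _.
set x := _^-1 => *; split; [nra|apply/andP; split; nra].
Qed.

(** Sieving by one more prime [p] removes the multiples of [p], which are counted
    by the previous sieve up to [n / p]; hence each prime doubles the error and
    adds at most 1 to it. *)
Lemma legendre_sieve (R : realFieldType) (ps : seq nat) (n : nat) :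
  uniq ps -> all prime ps ->
  `|(\sum_(0 <= k < n) all (fun p => ~~ (p %| k)%N) ps)%N%:R
    - n%:R * \prod_(p <- ps) (1 - p%:R^-1 : R)| <= 2 ^+ size ps - 1.
Proof.
elim: ps n => [|p ps IH] n.
  move=> _ _; rewrite big_nil mulr1 expr0 subrr.
  under eq_bigr do rewrite /=.
  by rewrite sum_nat_const_nat subn0 muln1 subrr normr0.
move=> /= /andP[pps ups] /andP[pp prps].
have p0 : (0 < p)%N := prime_gt0 pp.
have [m mn Fm] := sum_multiples n (fun k => all (fun p => ~~ (p %| k)%N) ps) p0.
have Em : (\sum_(0 <= k < n) ((p %| k) && all (fun q => ~~ (q %| k)%N) ps) =
  \sum_(0 <= j < m) all (fun q => ~~ (q %| j)) ps)%N.
  rewrite Fm; apply: eq_bigr => j _; congr nat_of_bool; apply: eq_in_all => q qps.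
  have pq := allP prps _ qps; rewrite Euclid_dvdM// dvdn_prime2//.
  by case: eqVneq qps => // ->; rewrite (negPf pps).
have E : (\sum_(0 <= k < n) all (fun q => ~~ (q %| k)) ps =
    \sum_(0 <= k < n) (~~ (p %| k) && all (fun q => ~~ (q %| k)) ps) +
    \sum_(0 <= j < m) all (fun q => ~~ (q %| j)) ps)%N.
  rewrite -Em -big_split/=; apply: eq_bigr => k _.
  by case: (p %| k)%N; rewrite /= ?addn0.
have := IH n ups prps; have := IH m ups prps.
have [_ /andP[]] := prod_1subV_bounds R prps.
rewrite E natrD big_cons exprS.
set Q := \prod_(_ <- _) _; set S1 := (\sum_(_ <= _ < n) _)%:R.
set S2 := (\sum_(_ <= _ < m) _)%:R; set e := _ ^+ _ => Q0 Q1 h1 h2.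
have e1 : 1 <= e by rewrite exprn_ege1// ler1n.
have x0 : (p%:R : R) > 0 by rewrite ltr0n.
have hm : (m%:R : R) = n%:R * p%:R^-1 + (m%:R - n%:R / p%:R) by ring.
have : 0 <= (m%:R : R) - n%:R / p%:R <= 1.
  rewrite subr_ge0 ler_pdivrMr// -natrM ler_nat lerBlDr -(ler_pM2r x0).
  rewrite mulrDl divfK ?gt_eqF// mul1r -natrM -natrD ler_nat.
  by rewrite [(m * p)%N]mulnC; case/andP: mn => -> /ltnW; rewrite addnC.
move: h1 h2; rewrite {}hm; set t := _ - n%:R / _; set y := n%:R * _.
rewrite !ler_norml => /andP[a1 a2] /andP[b1 b2] /andP[t0 t1].
have -> : S1 - n%:R * ((1 - p%:R^-1) * Q) =
  (S1 + S2 - n%:R * Q) - (S2 - (y + t) * Q) - t * Q by rewrite /y; ring.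
by apply/andP; split; nra.
Qed.

Lemma coprime_all_primes (k c : nat) : (0 < c)%N ->
  coprime k c = all (fun p => ~~ (p %| k)%N) (primes c).
Proof.
move=> c0; apply/idP/allP => [kc p|H].
  rewrite mem_primes => /and3P[pp _ pc]; apply/negP => pk.
  have : (p %| gcdn k c)%N by rewrite dvdn_gcd pk.
  by rewrite (eqP kc) dvdn1; case: eqP pp => // ->.
apply/negPn/negP => ckc.
have g1 : (1 < gcdn k c)%N.
  by rewrite ltn_neqAle eq_sym ckc/= gcdn_gt0 c0 orbT.
have := H (pdiv (gcdn k c)).
rewrite mem_primes pdiv_prime// c0/= (dvdn_trans (pdiv_dvd _) (dvdn_gcdr _ _)).
by rewrite (dvdn_trans (pdiv_dvd _) (dvdn_gcdl _ _)) => /(_ isT).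
Qed.

Lemma coprime_count_approx (R : realFieldType) (c n : nat) : (0 < c)%N ->
  `|(coprime_count c n)%:R - n%:R * coprime_ratio R c|
    <= 2 ^+ size (primes c).
Proof.
move=> c0; rewrite /coprime_count (eq_bigr _ (fun k _ => congr1 _ (coprime_all_primes k c0))).
apply: le_trans (@legendre_sieve R _ n (primes_uniq c) _) _.
  by apply/allP => p; rewrite mem_primes => /andP[].
by rewrite lerBlDr lerDl.
Qed.

Lemma coprime_ratio_ge (R : realFieldType) (c : nat) :
  1 - \sum_(p <- primes c) (p%:R^-1 : R) <= coprime_ratio R c.
Proof.
by apply: (@prod_1subV_bounds R _ _).1; apply/allP => p; rewrite mem_primes => /andP[].
Qed.

Lemma coprime_ratio01 (R : realFieldType) (c : nat) :
  0 <= coprime_ratio R c <= 1.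
Proof.
by apply: (@prod_1subV_bounds R _ _).2; apply/allP => p; rewrite mem_primes => /andP[].
Qed.

Lemma prod_primes_dvdn (ps : seq nat) (c : nat) :
  uniq ps -> {subset ps <= primes c} -> (\prod_(p <- ps) p %| c)%N.
Proof.
elim: ps => [|p ps IH]; first by rewrite big_nil dvd1n.
move=> /= /andP[pps ups] sub; rewrite big_cons Gauss_dvd; last first.
  elim: ps pps sub {IH ups} => [|q ps IH]; first by rewrite big_nil coprimen1.
  rewrite inE negb_or => /andP[pq pps] sub; rewrite big_cons coprimeMr IH//; last first.
    by move=> r; rewrite inE => /orP[/eqP ->|rps]; apply: sub; rewrite !inE ?eqxx ?rps ?orbT.
  have := sub p; have := sub q; rewrite !inE !eqxx/= orbT !mem_primes.
  move=> /(_ isT)/andP[qp _] /(_ isT)/andP[pp _].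
  by rewrite prime_coprime// dvdn_prime2// pq.
rewrite IH//; last by move=> q qps; apply: sub; rewrite inE qps orbT.
by rewrite andbT; have := sub p; rewrite inE eqxx mem_primes => /(_ isT)/and3P[].
Qed.

(** This makes the error [2 ^ omega(c)] of the sieve a [O(sqrt c)]: all primes are
    at least 4, except 2 and 3, each of which costs a factor 2. *)
Lemma expn_size_primes_le (c : nat) : (0 < c)%N ->
  (4 ^ size (primes c) <= 4 * c)%N.
Proof.
move=> c0.
have h (ps : seq nat) : all prime ps ->
    (4 ^ size ps <= (\prod_(p <- ps) p) * 2 ^ (count (mem [:: 2; 3]) ps))%N.
  elim: ps => [|p ps IH]; first by rewrite big_nil.
  move=> /= /andP[pp /IH {}IH]; rewrite expnS expnD big_cons.
  rewrite mulnACA leq_mul//.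
  case: p pp => [|[|[|[|p]]]]//= _; lia.
have primes_c : all prime (primes c).
  by apply/allP => p; rewrite mem_primes => /andP[].
apply: leq_trans (h _ primes_c) _; rewrite [leqRHS]mulnC; apply: leq_mul.
  by apply/dvdn_leq/prod_primes_dvdn => //; exact: primes_uniq.
rewrite (@leq_pexp2l 2 _ 2)// -size_filter.
apply: (@uniq_leq_size _ _ [:: 2; 3]); first exact: filter_uniq (primes_uniq _).
by move=> p; rewrite mem_filter => /andP[].
Qed.

(** Comparison with a telescoping sum, from the second term on. *)
Lemma sum_inv_sqr_le (R : realFieldType) (n : nat) :
  \sum_(2 <= q < n) (q%:R ^- 2 : R) <= 3 / 4.
Proof.
case: n => [|[|[|n]]]; [by rewrite big_geq//; lra..|].
suff : \sum_(2 <= q < n.+3) (q%:R ^- 2 : R) <= 3 / 4 - n.+2%:R^-1.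
  by move=> /le_trans; apply; rewrite lerBlDr lerDl invr_ge0.
elim: n => [|n IH]; first by rewrite big_nat1; lra.
rewrite big_nat_recr//=; apply: le_trans (lerD IH (lexx _)) _.
rewrite -addrA lerD2l -[n.+3%:R]natr1; set x : R := n.+2%:R.
have x0 : 0 < x by rewrite ltr0n.
have -> : - x^-1 + (x + 1) ^- 2 = - (x + 1)^-1 - (x * (x + 1) ^+ 2)^-1.
  by field; rewrite !gt_eqF// addr_gt0.
by rewrite gerDl oppr_le0 invr_ge0 mulr_ge0 ?sqr_ge0// ltW.
Qed.

(** On average over [c], the factors [1 - 1 / p] with [p] dividing [c] take away at
    most the sum of [1 / q ^ 2] over [q >= 2], which stays below 1. *)
Lemma sum_coprime_ratio_ge (R : realFieldType) (n : nat) :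
  n%:R / 4 <= \sum_(1 <= c < n.+1) coprime_ratio R c.
Proof.
have inv0 (q : nat) : 0 <= (q%:R : R)^-1 by rewrite invr_ge0.
have step c : (0 < c <= n)%N -> 1 - \sum_(2 <= q < n.+1) (q %| c)%:R * (q%:R^-1 : R)
    <= coprime_ratio R c.
  move=> /andP[c0 cn]; apply: le_trans (coprime_ratio_ge R c); rewrite lerD2l lerN2.
  rewrite [leRHS](bigID (mem (primes c)))/= -[leLHS]addr0 lerD//; last first.
    by apply: sumr_ge0 => q _; rewrite mulr_ge0.
  have pr : perm_eq (primes c) [seq q <- index_iota 2 n.+1 | q \in primes c].
    apply: uniq_perm; rewrite ?primes_uniq ?filter_uniq ?iota_uniq// => q.
    rewrite mem_filter mem_index_iota mem_primes.
    case: (boolP (prime q)) => //= pq; rewrite c0/=.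
    case: (boolP (q %| c)%N) => //= /(dvdn_leq c0) qc.
    by rewrite prime_gt1//= ltnS (leq_trans qc).
  rewrite (perm_big _ pr) big_filter; apply: ler_sum => q.
  by rewrite mem_primes => /and3P[_ _ ->]; rewrite mul1r.
apply: le_trans (_ : \sum_(1 <= c < n.+1)
    (1 - \sum_(2 <= q < n.+1) (q %| c)%:R * (q%:R^-1 : R)) <= _); last first.
  by apply: ler_sum_nat => c; rewrite ltnS => cn; exact: step.
rewrite sumrB sumr_const_nat subSS subn0 exchange_big/=.
have mult (q : nat) : (1 < q)%N ->
    \sum_(1 <= c < n.+1) (q %| c)%:R * (q%:R^-1 : R) <= n%:R * q%:R ^- 2.
  move=> q1; have q0 : (0 < q)%N by exact: ltnW.
  rewrite -mulr_suml expr2 invfM mulrA ler_wpM2r//.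
  rewrite ler_pdivlMr ?ltr0n// -natr_sum -natrM ler_nat.
  suff -> : (\sum_(1 <= c < n.+1) (q %| c) = n %/ q)%N by exact: leq_trunc_div.
  elim: n {step} => [|m IH]; first by rewrite big_geq// div0n.
  by rewrite big_nat_recr//= IH divnS// addnC.
have : \sum_(2 <= q < n.+1) \sum_(1 <= c < n.+1) (q %| c)%:R * (q%:R^-1 : R) <=
    n%:R * (3 / 4).
  apply: le_trans (ler_wpM2l (ler0n _ _) (@sum_inv_sqr_le R n.+1)).
  by rewrite mulr_sumr; apply: ler_sum_nat => q /andP[q1 _]; exact: mult.
by lra.
Qed.

(** * Lebesgue measure of subsets of the line in intervals *)

Section interval_measure.
Context (R : realType).
Local Notation mu := (@lebesgue_measure R).
Implicit Types (T : set (measurableTypeR R)) (a b c : R).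

Lemma preimage_measure d d' (T1 : measurableType d) (T2 : measurableType d')
    (m : {measure set T1 -> \bar R}) (f : T1 -> T2) :
  measurable_fun [set: T1] f ->
  exists m' : {measure set T2 -> \bar R}, forall X, m' X = m (f @^-1` X).
Proof. by move=> mf; unshelve eexists (pushforward m f). Qed.

Lemma measure_ocitv_unique (m1 m2 : {measure set (measurableTypeR R) -> \bar R}) :
  (forall a b, m1 `]a, b]%classic = m2 `]a, b]%classic) ->
  (forall a b, m1 `]a, b]%classic < +oo)%E ->
  forall A, measurable A -> m1 A = m2 A.
Proof.
move=> m12 m1oo A mA.
apply: (@measure_unique _ R (measurableTypeR R) (@ocitv R) (fun n => `](- n%:R), n%:R]%classic) _ _ _ _ m1 m2) => //.
- exact: ocitvI.
- by move=> i; exact: is_ocitv.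
- apply/seteqP; split=> // x _; exists (Num.truncn `|x|).+1 => //=.
  rewrite in_itv/=; have := truncnS_gt `|x|; rewrite ltr_norml => /andP[-> /ltW//].
- by move=> _ [[a b] _ <-].
Qed.

(** Real-valued, because the estimates below subtract such measures. *)
Definition itv_measure T a b : R := fine (mu (T `&` `]a, b]%classic)).

Lemma measurable_setI_itvoc T a b : measurable T ->
  measurable (T `&` `]a, b]%classic : set (measurableTypeR R)).
Proof. by move=> mT; exact: measurableI. Qed.

Lemma itv_measureE T a b : measurable T ->
  mu (T `&` `]a, b]%classic) = (itv_measure T a b)%:E.
Proof.
move=> mT; rewrite fineK// ge0_fin_numE//.
apply: le_lt_trans (_ : mu `]a, b]%classic < +oo)%E.
  by apply: le_measure; rewrite ?inE//; exact: measurableI.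
by rewrite lebesgue_measure_itv/=; case: ifP => // _; rewrite ltry.
Qed.

Lemma itv_measure_ge0 T a b : 0 <= itv_measure T a b.
Proof. by rewrite fine_ge0. Qed.

Lemma lebesgue_itvoc a b : a <= b -> mu `]a, b]%classic = (b - a)%:E.
Proof.
rewrite le_eqVlt lebesgue_measure_itv/= lte_fin => /predU1P[->|->]//.
by rewrite ltxx subrr.
Qed.

Lemma itv_measure_le T a b : measurable T -> a <= b -> itv_measure T a b <= b - a.
Proof.
move=> mT ab; rewrite -lee_fin -itv_measureE// -lebesgue_itvoc//.
by apply: le_measure; rewrite ?inE//; exact: measurableI.
Qed.

Lemma le_itv_measure T T' a b a' b' : measurable T -> measurable T' ->
  T `&` `]a, b]%classic `<=` T' `&` `]a', b']%classic ->
  itv_measure T a b <= itv_measure T' a' b'.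
Proof.
move=> mT mT' sub; rewrite -lee_fin -!itv_measureE//.
by apply: le_measure; rewrite ?inE//; exact: measurableI.
Qed.

Lemma itv_measure_itvS T a b a' b' : measurable T -> a' <= a -> b <= b' ->
  itv_measure T a b <= itv_measure T a' b'.
Proof.
move=> mT aa bb; apply: le_itv_measure => // x [Tx]; rewrite /= !in_itv/= => /andP[ax xb].
by split=> //=; rewrite ?in_itv/= (le_lt_trans aa ax) (le_trans xb bb).
Qed.

Lemma itv_measure_cat T a b c : measurable T -> a <= b -> b <= c ->
  itv_measure T a c = itv_measure T a b + itv_measure T b c.
Proof.
move=> mT ab bc; apply: EFin_inj; rewrite EFinD -!itv_measureE//.
rewrite -measureU//; try exact: measurableI.
  rewrite -setIUr; congr (mu (_ `&` _)); apply/seteqP; split=> x /=.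
    rewrite !in_itv/= => /andP[ax xc].
    by have [xb|bx] := leP x b; [left; rewrite ax|right].
  by rewrite !in_itv/= => -[/andP[ax xb]|/andP[bx xc]];
    [rewrite ax (le_trans xb)|rewrite (le_lt_trans ab)].
apply/seteqP; split=> // x [[_ +] [_ +]] /=.
by rewrite /= !in_itv/= => /andP[_ xb]; rewrite ltNge xb.
Qed.

Lemma measurable_affine_preimage T a b : measurable T ->
  measurable ((fun t => a * t + b) @^-1` T : set (measurableTypeR R)).
Proof.
move=> mT; rewrite -[X in measurable X]setTI.
by apply: (_ : measurable_fun setT (fun t : R => a * t + b)) => //; exact: measurable_funD.
Qed.

Lemma lebesgue_affine T a b : a != 0 -> measurable T ->
  mu ((fun t => a * t + b) @^-1` T) = ((`|a|^-1)%:E * mu T)%E.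
Proof.
wlog a0 : a T / 0 < a => [H|].
  case: (ltgtP a 0) => [a0 _ mT|a0 _ mT|//]; last first.
    by apply: H; rewrite ?gt_eqF.
  have /H H' : 0 < - a by rewrite oppr_gt0.
  rewrite -normrN -H' ?oppr_eq0 ?lt_eqF//.
  rewrite -lebesgue_measureN; last exact: measurable_affine_preimage.
  by rewrite /pushforward; congr (mu _); apply/seteqP; split=> x /=; rewrite mulrN mulNr.
move=> _ mT; rewrite gtr0_norm//.
pose f (t : measurableTypeR R) : measurableTypeR R := a * t + b.
have mf : measurable_fun setT f by exact: measurable_funD.
have [m' m'E] := preimage_measure mu mf.
suff -> : mu T = mscale (NngNum (ltW a0)) m' T.
  by rewrite /mscale/= m'E muleA -EFinM mulVf ?gt_eqF// mul1e.
apply: (@lebesgue_measure_unique _ (mscale _ m')) => // _ [[x y] _ <-] /=.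
rewrite /mscale/= m'E/= /f.
have -> : (fun t => a * t + b) @^-1` `]x, y]%classic = `](x - b) / a, (y - b) / a]%classic.
  apply/seteqP; split=> t /=; rewrite !in_itv/=.
    by rewrite ltr_pdivrMr// ler_pdivlMr// ltrBlDr lerBrDr mulrC.
  by rewrite ltr_pdivrMr// ler_pdivlMr// ltrBlDr lerBrDr mulrC.
rewrite !lebesgue_measure_itv/= !lte_fin ltr_pM2r ?invr_gt0// ltrD2r.
case: ifP => _; last by rewrite mule0.
by rewrite -!EFinB -EFinM; congr EFin; field; rewrite gt_eqF.
Qed.

Lemma itv_measure_affine T a b x y : 0 < a -> measurable T ->
  itv_measure ((fun t => a * t + b) @^-1` T) x y = a^-1 * itv_measure T (a * x + b) (a * y + b).
Proof.
move=> a0 mT; apply: EFin_inj; rewrite EFinM -!itv_measureE//; last first.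
  exact: measurable_affine_preimage.
rewrite -[X in X^-1]gtr0_norm// -(lebesgue_affine b)// ?gt_eqF//; last first.
  exact: measurable_setI_itvoc.
congr (mu _); apply/seteqP; split=> t /= -[? h]; split=> //; move: h;
  by rewrite /= !in_itv/= ltrD2r lerD2r ltr_pM2l// ler_pM2l.
Qed.

Lemma le_lebesgue_setU1 T T' p : measurable T -> measurable T' ->
  T `<=` T' `|` [set p] -> (mu T <= mu T')%E.
Proof.
move=> mT mT' sub; apply: le_trans (_ : mu (T' `|` [set p]) <= _)%E.
  by apply: le_measure; rewrite ?inE//; exact: measurableU.
apply: (le_trans (measureU2 _ mT' (measurable_set1 p))).
by rewrite [X in (_ + X)%E](@lebesgue_measure_set1 R p) adde0.
Qed.

Lemma itv_measure_affineN T a b x y : a < 0 -> measurable T ->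
  itv_measure ((fun t => a * t + b) @^-1` T) x y =
    (- a)^-1 * itv_measure T (a * y + b) (a * x + b).
Proof.
move=> a0 mT; apply: EFin_inj; rewrite EFinM -!itv_measureE//; last first.
  exact: measurable_affine_preimage.
have mTco : measurable (T `&` `[a * y + b, a * x + b[%classic : set (measurableTypeR R)).
  exact: measurableI.
have -> : mu (T `&` `]a * y + b, a * x + b]%classic) = mu (T `&` `[a * y + b, a * x + b[%classic).
  apply/eqP; rewrite eq_le; apply/andP; split.
    apply: (@le_lebesgue_setU1 _ _ (a * x + b)) => //; first exact: measurable_setI_itvoc.
    move=> t [Tt] /=; rewrite !in_itv/= => /andP[h1]; rewrite le_eqVlt => /predU1P[->|h2].
      by right.
    by left; split=> //; rewrite /= ?in_itv/= ltW.
  apply: (@le_lebesgue_setU1 _ _ (a * y + b)) => //; first exact: measurable_setI_itvoc.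
  move=> t [Tt] /=; rewrite !in_itv/= => /andP[]; rewrite le_eqVlt => /predU1P[->|h1 h2].
    by right.
  by left; split=> //; rewrite /= ?in_itv/= h1 ltW.
rewrite -[X in X^-1]ltr0_norm// -(lebesgue_affine b)// ?lt_eqF//.
congr (mu _); apply/seteqP; split=> t /= -[? h]; split=> //; move: h;
  by rewrite /= !in_itv/= ltrD2r lerD2r ltr_nM2l// ler_nM2l// andbC.
Qed.

Lemma itv_measure_windows T tau (k : int) (j : nat) : measurable T -> 0 <= tau ->
  (forall t, T (t + tau) <-> T t) ->
  itv_measure T (k%:~R * tau) (k%:~R * tau + j%:R * tau) = j%:R * itv_measure T 0 tau.
Proof.
move=> mT tau0 perT; set q := itv_measure T 0 tau.
have perN (n : nat) t : T (t + n%:R * tau) <-> T t.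
  elim: n => [|n IH]; first by rewrite mul0r addr0.
  by rewrite -natr1 mulrDl mul1r addrA perT.
have perZ (z : int) t : T (t + z%:~R * tau) <-> T t.
  case: z => n; first exact: perN.
  by rewrite NegzE mulrNz mulNr; have := perN n.+1 (t - n.+1%:R * tau); rewrite subrK => h; symmetry.
elim: j => [|j IH].
  rewrite !mul0r addr0; apply/eqP; rewrite eq_le itv_measure_ge0 andbT.
  by rewrite -[leRHS](subrr (k%:~R * tau)) itv_measure_le.
rewrite (@itv_measure_cat _ _ (k%:~R * tau + j%:R * tau)) ?IH//; last 2 first.
  by rewrite lerDl mulr_ge0.
  by rewrite lerD2l ler_wpM2r// ler_nat.
rewrite -natr1 [RHS]mulrDl mul1r; congr (_ + _).
have E : T = (fun t => 1 * t + (k%:~R * tau + j%:R * tau)) @^-1` T.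
  by apply/seteqP; split=> t /=; rewrite mul1r -mulrDl
    (_ : k%:~R + j%:R = (k + j%:Z)%:~R) ?perZ// intrD.
rewrite /q [in RHS]E itv_measure_affine// invr1 !mul1r add0r; congr itv_measure.
by rewrite mulrDl mul1r; ring.
Qed.

(** [`]a, b]`] contains, and is covered by, whole periods of total length within
    [2 * tau] of [b - a]. *)
Lemma itv_measure_periodic T tau a b : measurable T -> 0 < tau -> a <= b ->
  (forall t, T (t + tau) <-> T t) ->
  `|itv_measure T a b - (b - a) * (itv_measure T 0 tau / tau)| <= 2 * tau.
Proof.
move=> mT tau0 ab perT; set q := itv_measure T 0 tau.
have q0 : 0 <= q by exact: itv_measure_ge0.
have qtau : q <= tau by rewrite -[leRHS]subr0; apply: itv_measure_le => //; exact: ltW.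
have windows k j := @itv_measure_windows T tau k j mT (ltW tau0) perT.
pose m := Num.floor (a / tau); pose M := Num.floor (b / tau).
have /andP[m1 m2] : m%:~R * tau <= a < m%:~R * tau + tau.
  have := floor_itv (a / tau).
  by rewrite ler_pdivlMr// ltr_pdivrMr// intrD mulrDl mul1r.
have /andP[M1 M2] : M%:~R * tau <= b < M%:~R * tau + tau.
  have := floor_itv (b / tau).
  by rewrite ler_pdivlMr// ltr_pdivrMr// intrD mulrDl mul1r.
have mM : m <= M by apply: le_floor; rewrite ler_pM2r ?invr_gt0.
have [j Ej] : exists j : nat, M = m + j%:Z.
  by exists `|M - m|%N; rewrite gez0_abs ?subr_ge0// [RHS]addrC subrK.
have EM : M%:~R = m%:~R + j%:R :> R by rewrite Ej intrD.
move: M1 M2; rewrite EM mulrDl => M1 M2.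
set r := q / tau; have rq : q = r * tau by rewrite /r divfK ?gt_eqF.
have r0 : 0 <= r by rewrite divr_ge0// ltW.
have r1 : r <= 1 by rewrite ler_pdivrMr// mul1r.
rewrite ler_norml; apply/andP; split; last first.
  have : itv_measure T a b <= j.+1%:R * q.
    by rewrite -(windows m); apply: itv_measure_itvS => //; rewrite -natr1 mulrDl; lra.
  rewrite rq -natr1; nra.
case: j Ej EM M1 M2 => [|j] Ej EM M1 M2.
  have := itv_measure_ge0 T a b; nra.
have : j%:R * q <= itv_measure T a b.
  rewrite -(windows (m + 1)); apply: itv_measure_itvS => //.
    by rewrite intrD mulrDl mul1r ltW.
  by move: M1; rewrite intrD -natr1; lra.
rewrite rq; move: M2; rewrite -natr1; nra.
Qed.

(** The measures [A |-> mu (A `&` T)] and [kappa * mu] agree on intervals, hence on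
    Borel sets; taking for [A] the complement of [T], either [kappa] or the
    measure of this complement vanishes. *)
Lemma lebesgue_zero_one T kappa : measurable T ->
  (forall a b, a <= b -> itv_measure T a b = kappa * (b - a)) ->
  mu T = 0%E \/ mu (~` T) = 0%E.
Proof.
move=> mT TI.
have k0 : 0 <= kappa by have := TI 0 1 ler01; rewrite subr0 mulr1 => <-; exact: itv_measure_ge0.
have E A : measurable A -> mu (A `&` T) = (kappa%:E * mu A)%E.
  apply: (@measure_ocitv_unique (mrestr mu mT) (mscale (NngNum k0) mu)).
    move=> a b; rewrite /= /mrestr /mscale/= setIC itv_measureE//.
    have [ab|ba] := leP a b; first by rewrite lebesgue_itvoc// TI// EFinM.
    by rewrite -itv_measureE// set_itv_ge ?setI0 ?measure0 ?mule0// -leNgt/= bnd_simp ltW.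
  by move=> a b; rewrite /= /mrestr setIC itv_measureE// ltry.
have [k00|kn0] := eqVneq kappa 0.
  by left; have := E T mT; rewrite setIid k00 mul0e.
right; have := E _ (measurableC mT); rewrite setICl measure0 => /esym/eqP.
by rewrite mule_eq0 eqe (negPf kn0)/= => /eqP.
Qed.

End interval_measure.

(** * Sums over Farey fractions *)

(** A pair [(c, k)] stands for the primitive linear form [(x, y) |-> c x - k y],
    which vanishes on the line of slope [x / y = k / c]. One period of slopes is
    enough, by invariance under [(x, y) |-> (x + y, y)]. *)
Definition farey (N : nat) : seq (nat * nat) :=
  [seq (c, k) | c <- index_iota 1 N.+1,
                k <- [seq k <- index_iota 0 c | coprime k c]].

Lemma mem_farey N c k :
  ((c, k) \in farey N) = [&& (0 < c <= N)%N, (k < c)%N & coprime k c].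
Proof.
apply/allpairsPdep/idP => [[c' [k' [+ + [-> ->]]]]|/and3P[cN kc ck]].
  by rewrite mem_filter !mem_index_iota ltnS => -> /andP[-> /= ->].
by exists c, k; rewrite mem_filter !mem_index_iota ltnS cN ck kc.
Qed.

Lemma farey_uniq N : uniq (farey N).
Proof.
apply: allpairs_uniq_dep; first exact: iota_uniq.
  by move=> c _; rewrite filter_uniq// iota_uniq.
by move=> [c k] [c' k'] _ _ /= [-> ->].
Qed.

Lemma sum_farey (V : nmodType) N (F : nat -> nat -> V) :
  \sum_(i <- farey N) F i.1 i.2 =
  \sum_(1 <= c < N.+1) \sum_(0 <= k < c | coprime k c) F c k.
Proof.
rewrite /farey big_allpairs_dep/=.
by apply: eq_bigr => c _; rewrite big_filter.
Qed.

Section farey_strips.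
Context (R : realType).
Local Notation mu := (@lebesgue_measure R).
Implicit Types (T : set (measurableTypeR R)).

Lemma le_sum_disjoint (I : eqType) (s : seq I) (X : I -> set (measurableTypeR R))
    (Z : set (measurableTypeR R)) : uniq s ->
  (forall i, measurable (X i)) -> measurable Z ->
  {in s, forall i, X i `<=` Z} ->
  {in s &, forall i j, i != j -> X i `&` X j = set0} ->
  (\sum_(i <- s) mu (X i) <= mu Z)%E.
Proof.
move=> + mX; elim: s Z => [|i s IH] Z /=; first by rewrite big_nil measure_ge0.
move=> /andP[iis us] mZ XZ dX; rewrite big_cons.
have -> : mu Z = (mu (Z `&` X i) + mu (Z `\` X i))%E.
  rewrite -measureU ?setUIDK//; [exact: measurableI|exact: measurableD|].
  by apply/seteqP; split=> // x [[_ ?] []].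
apply: leeD.
  by rewrite (setIidr (XZ i _)) ?mem_head.
apply: IH => //; first exact: measurableD.
  move=> j js x Xjx; split; first by apply: (XZ j) => //; rewrite inE js orbT.
  move=> Xix; have : (X i `&` X j) x by [].
  rewrite dX ?inE ?eqxx ?js ?orbT//.
  by apply: contraNneq iis => ->.
by move=> j k js ks; apply: dX; rewrite inE ?js ?ks orbT.
Qed.

(** In a sum over the fractions [k / c] of one denominator, those with
    [(k + 1) / c <= b] contribute about [v], those beyond [b] nothing, and at most one straddles
    [b]. The sieve says that about [c * b * coprime_ratio c] of them are before
    [b]. This is used with [g] the length of a strip and with [g] the mass of an
    invariant set in a strip. *)
Lemma farey_row (c : nat) (b v w e : R) (g : nat -> R) : (0 < c)%N ->
  0 <= b <= 1 -> 0 <= v <= w -> 0 <= e ->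
  (forall k, (k < c)%N -> coprime k c -> 0 <= g k <= w) ->
  (forall k, (k < c)%N -> coprime k c -> c%:R * b <= k%:R -> g k = 0) ->
  (forall k, (k < c)%N -> coprime k c -> k.+1%:R <= c%:R * b -> `|g k - v| <= e) ->
  `|\sum_(0 <= k < c | coprime k c) g k - v * c%:R * b * coprime_ratio R c|
    <= w * (2 ^+ size (primes c) + 2) + c%:R * e.
Proof.
move=> c0 /andP[b0 b1] /andP[v0 vw] e0 g0w gout gin.
have cR0 : 0 < c%:R :> R by rewrite ltr0n.
pose m := Num.truncn (c%:R * b).
have cb0 : 0 <= c%:R * b by rewrite mulr_ge0.
have /andP[m1 m2] : m%:R <= c%:R * b < m.+1%:R by exact: truncn_itv.
have mc : (m <= c)%N.
  by rewrite -(@ler_nat R) (le_trans m1)// ler_piMr// ltW.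
have w0 : 0 <= w := le_trans v0 vw.
have approx := coprime_count_approx R m c0.
have /andP[r0 r1] := coprime_ratio01 R c.
rewrite big_mkcond/=.
rewrite (@big_cat_nat _ _ _ m)//=.
have head : `|\sum_(0 <= k < m) (if coprime k c then g k else 0)
   - v * (coprime_count c m)%:R| <= c%:R * e.
  rewrite /coprime_count natr_sum mulr_sumr -sumrB.
  apply: le_trans (ler_norm_sum _ _ _) _.
  apply: le_trans (_ : \sum_(0 <= k < m) e <= _); last first.
    by rewrite sumr_const_nat subn0 -[leLHS]mulr_natl ler_wpM2r// ler_nat.
  apply: ler_sum_nat => k /andP[_ km].
  case: ifPn => ck; last by rewrite mulr0 subrr normr0.
  rewrite mulr1; apply: gin => //; first exact: leq_trans mc.
  by apply: le_trans m1; rewrite ler_nat.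
have tail : 0 <= \sum_(m <= k < c) (if coprime k c then g k else 0) <= w.
  move: mc; rewrite leq_eqVlt => /predU1P[<-|mc].
    by rewrite big_geq// lexx.
  rewrite big_ltn// big1_seq ?addr0; last first.
    move=> k; rewrite mem_index_iota => /andP[_ /andP[mk kc]].
    case: ifPn => // ck; apply: gout => //.
    by rewrite (le_trans (ltW m2))// ler_nat.
  by case: ifPn => cm; [exact: g0w|rewrite lexx w0].
move: head tail approx; set H := \sum_(0 <= _ < m) _; set L := \sum_(m <= _ < c) _.
set Q := (coprime_count c m)%:R; set rho := coprime_ratio R c; set P := 2 ^+ _.
move=> hd /andP[L0 Lw] ap.
have -> : H + L - v * c%:R * b * rho = (H - v * Q) + L
    + v * (Q - m%:R * rho) - v * (c%:R * b - m%:R) * rho by ring.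
have e1 : `|v * (Q - m%:R * rho)| <= w * P.
  by rewrite normrM ger0_norm// ler_pM.
have e2 : 0 <= v * (c%:R * b - m%:R) * rho <= w.
  have : 0 <= c%:R * b - m%:R <= 1 by rewrite subr_ge0 m1/= lerBlDr -natr1 in m2 *; lra.
  move=> /andP[d0 d1]; rewrite !mulr_ge0//=.
  by rewrite -[leRHS]mulr1 ler_pM ?mulr_ge0// -[leRHS]mulr1 ler_pM.
move: hd e1 e2; rewrite !ler_norml => /andP[? ?] /andP[? ?] /andP[? ?].
by apply/andP; split; lra.
Qed.

Definition farey_err (N : nat) : R :=
  N.+1%:R^-1 * \sum_(1 <= c < N.+2) (2 ^+ size (primes c) + 2) / c%:R.

Definition farey_density (N : nat) : R :=
  N.+1%:R^-1 * \sum_(1 <= c < N.+2) coprime_ratio R c.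

Lemma farey_density_bounds N : 4^-1 <= farey_density N <= 1.
Proof.
rewrite /farey_density !(ler_pdivlMl, ler_pdivrMl)// mulr1.
rewrite sum_coprime_ratio_ge/=.
apply: le_trans (_ : \sum_(1 <= c < N.+2) (1 : R) <= _).
  by apply: ler_sum => c _; case/andP: (coprime_ratio01 R c).
by rewrite sumr_const_nat subSS subn0.
Qed.

(** A Cesaro mean of terms of size [O(1 / sqrt c)]. *)
Lemma cvg_farey_err : farey_err N @[N --> \oo] --> 0.
Proof.
pose u (n : nat) : R := (2 ^+ size (primes n.+1) + 2) / n.+1%:R.
have -> : farey_err = arithmetic_mean u.
  apply/funext => n; rewrite /farey_err /arithmetic_mean/= seriesEnat/=.
  by congr (_ * _); rewrite big_add1.
apply: cesaro; apply/cvgrPdist_lt => eps eps0.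
near=> n; rewrite sub0r normrN /u ger0_norm; last first.
  by rewrite divr_ge0// addr_ge0// exprn_ge0.
rewrite ltr_pdivrMr// -(@ltr_pXn2r _ 2)// ?nnegrE ?addr_ge0 ?exprn_ge0 ?mulr_ge0 ?ltW//.
have big : 16 / eps ^+ 2 < n.+1%:R.
  apply: lt_trans (_ : n%:R < _); last by rewrite ltr_nat.
  by near: n; exact: nbhs_infty_gtr.
have := expn_size_primes_le (ltn0Sn n); set P := 2 ^+ _.
rewrite -(ler_nat R) natrM natrX.
have -> : (4%:R : R) ^+ size (primes n.+1) = P ^+ 2.
  by rewrite -exprM mulnC exprM; congr (_ ^+ _); rewrite -natrX.
set c : R := n.+1%:R in big *.
have c1 : 1 <= c by rewrite ler1n.
move: big; rewrite ltr_pdivrMr ?exprn_gt0// => big P4.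
have := sqr_ge0 (P - 2); nra.
Unshelve. all: by end_near.
Qed.

End farey_strips.

(** * The strips at a given height *)

Section equidistribution.
Context (R : realType).
Local Notation mu := (@lebesgue_measure R).
Implicit Types (T : set (measurableTypeR R)).

(** At height [y], the strip [0 < c x - k y <= sigma] is the interval of slopes
    from [k / c] to this point. *)
Definition strip_end (sigma y : R) (i : nat * nat) : R :=
  i.2%:R / i.1%:R + sigma / (i.1%:R * y).

(** The factor [y] turns lengths of sets of slopes into lengths in the plane. *)
Definition strip_sum (N : nat) (sigma y : R) T : R :=
  \sum_(i <- farey N) y * itv_measure T (i.2%:R / i.1%:R) (strip_end sigma y i).

Lemma in_strip (sigma y t : R) (c k : nat) : (0 < c)%N -> 0 < y ->
  (t \in `]k%:R / c%:R, strip_end sigma y (c, k)]) =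
  (0 < (c%:R * t - k%:R) * y <= sigma).
Proof.
move=> c0 y0; have cR : 0 < c%:R :> R by rewrite ltr0n.
rewrite in_itv/= /strip_end/= ltr_pdivrMr// pmulr_lgt0// subr_gt0 mulrC.
congr (_ && _); rewrite -lerBlDl -(ler_pM2r (mulr_gt0 cR y0)).
rewrite [X in _ <= X]divfK ?mulf_neq0 ?gt_eqF//.
by congr (_ <= _); field; rewrite gt_eqF.
Qed.

(** The strips are pairwise disjoint. If [s] and [s'] are the values at one point
    of the forms attached to [(c, k)] and [(c', k')], then [c s' - c' s] is an
    integer multiple of [y], and it is smaller than [N * sigma <= y] in absolute
    value. So it vanishes, and by coprimality the two pairs are equal. *)
Lemma strip_sum_le (N : nat) (sigma y : R) T : measurable T ->
  0 < y -> 0 < sigma -> N%:R * sigma <= y ->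
  strip_sum N sigma y T <= y * itv_measure T 0 1.
Proof.
move=> mT y0 s0 Ns; rewrite /strip_sum -mulr_sumr ler_pM2l//.
rewrite -lee_fin -sumEFin -itv_measureE//.
under eq_bigr do rewrite -itv_measureE//.
have sy1 c k : (c, k) \in farey N -> sigma <= y.
  rewrite mem_farey => /andP[/andP[c1 cN] _]; apply: le_trans Ns.
  by apply: ler_peMl; [exact: ltW|rewrite ler1n (leq_trans c1)].
apply: le_sum_disjoint; first exact: farey_uniq.
- by move=> i; exact: measurable_setI_itvoc.
- exact: measurable_setI_itvoc.
- move=> [c k] ckN t [Tt] /= tck; split=> //=.
  move: (ckN); rewrite mem_farey => /and3P[/andP[c0 cN] kc _].
  have cR : 0 < c%:R :> R by rewrite ltr0n.
  move: tck; rewrite in_strip// in_itv/= pmulr_lgt0// subr_gt0 => /andP[t0 t1].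
  have kc' : k%:R + 1 <= c%:R :> R by rewrite natr1 ler_nat.
  have t0' : 0 < t by rewrite -(pmulr_rgt0 _ cR) (le_lt_trans _ t0).
  rewrite t0'/= -(ler_pM2l cR) mulr1; apply: le_trans kc'.
  rewrite -lerBlDl -(ler_pM2r y0) mul1r (le_trans t1)//; exact: sy1 ckN.
move=> [c k] [c' k'] ck ck' ne; apply/seteqP; split=> // t [[_ +] [_ +]] /=.
move: ck ck'; rewrite !mem_farey => /and3P[/andP[c0 cN] kc cop].
move=> /and3P[/andP[c'0 c'N] kc' cop']; rewrite /= !in_strip//.
set s := (_ - _) * y; set s' := (_ - _) * y => /andP[s1 s2] /andP[s1' s2'].
have E : c%:R * s' - c'%:R * s = ((c' * k)%:R - (c * k')%:R) * y.
  by rewrite /s /s' !natrM; ring.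
have cR : 0 < c%:R :> R by rewrite ltr0n.
have c'R : 0 < c'%:R :> R by rewrite ltr0n.
have cN' : c%:R <= N%:R :> R by rewrite ler_nat.
have c'N' : c'%:R <= N%:R :> R by rewrite ler_nat.
have h1 : c%:R * s' <= y by apply: le_trans Ns; rewrite ler_pM// ltW.
have h2 : c'%:R * s <= y by apply: le_trans Ns; rewrite ler_pM// ltW.
have h3 : 0 < c%:R * s' by rewrite mulr_gt0.
have h4 : 0 < c'%:R * s by rewrite mulr_gt0.
have : `|(c' * k)%:R - (c * k')%:R| < (1 : R).
  rewrite -(ltr_pM2r y0) mul1r -{1}(gtr0_norm y0) -normrM -E ltr_norml.
  by apply/andP; split; lra.
rewrite -[_%:R]/((_%:Z)%:~R) -[X in _ - X]/((_%:Z)%:~R) -intrB -intr_norm.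
rewrite (@ltrz1 R) -abszE ltz_nat ltnS leqn0 absz_eq0 subr_eq0 => /eqP[eq].
have cc : c = c'.
  apply/eqP; rewrite eqn_dvd -(@Gauss_dvdl c c' k) 1?coprime_sym//.
  rewrite -(@Gauss_dvdl c' c k') 1?coprime_sym//.
  by rewrite eq dvdn_mulr//= -eq dvdn_mulr.
move: ne; rewrite cc xpair_eqE eqxx/= => /eqP[].
by move: eq; rewrite cc => /eqP; rewrite eqn_pmul2l// => /eqP.
Qed.

Lemma itv_measure_itv0 (b x z : R) : x <= z -> 0 <= x ->
  itv_measure `]0, b]%classic x z = Num.max 0 (Num.min z b - x).
Proof.
move=> xz x0; apply: EFin_inj; rewrite -itv_measureE//.
have -> : `]0, b]%classic `&` `]x, z]%classic = `]x, Num.min z b]%classic :> set R.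
  apply/seteqP; split=> t /=; rewrite !in_itv/= le_min.
    by move=> [/andP[_ ->] /andP[-> ->]].
  by move=> /and3P[xt -> ->]; rewrite xt (le_lt_trans x0 xt).
have [h|h] := leP x (Num.min z b).
  by rewrite lebesgue_itvoc//; congr EFin; rewrite max_r ?subr_ge0.
rewrite set_itv_ge ?measure0 -?leNgt ?bnd_simp ?ltW//.
by rewrite max_l// subr_le0 ltW.
Qed.

Lemma strip_sum_itv (n : nat) (sigma y b : R) : 0 <= b <= 1 -> 0 < sigma ->
  sigma <= y ->
  `|strip_sum n.+1 sigma y `]0, b]%classic - n.+1%:R * sigma * b * farey_density R n|
    <= n.+1%:R * sigma * farey_err R n.
Proof.
move=> b01 s0 sy; have y0 : 0 < y := lt_le_trans s0 sy.
rewrite /strip_sum (sum_farey _ (fun c k => y * itv_measure `]0, b]%classic (k%:R / c%:R)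
  (strip_end sigma y (c, k)))).
rewrite /farey_density /farey_err.
have N0 : n.+1%:R != 0 :> R by rewrite pnatr_eq0.
set S := \sum_(_ <= _ < _) coprime_ratio R _; set Q := \sum_(_ <= _ < _) (_ / _).
have -> : n.+1%:R * sigma * b * (n.+1%:R^-1 * S) = sigma * b * S by field.
have -> : n.+1%:R * sigma * (n.+1%:R^-1 * Q) = sigma * Q by field.
rewrite /S /Q !mulr_sumr -sumrB; apply: le_trans (ler_norm_sum _ _ _) _.
apply: ler_sum_nat => c /andP[c0 _].
have cR : 0 < c%:R :> R by rewrite ltr0n.
have row := @farey_row R c b (sigma / c%:R) (sigma / c%:R) 0
  (fun k => y * itv_measure `]0, b]%classic (k%:R / c%:R) (strip_end sigma y (c, k))) c0 b01.
have sc0 : 0 <= sigma / c%:R by rewrite divr_ge0 ?ltW.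
have E : sigma / c%:R * c%:R * b * coprime_ratio R c = sigma * b * coprime_ratio R c.
  by rewrite divfK ?gt_eqF.
rewrite -E.
have -> : sigma * ((2 ^+ size (primes c) + 2) / c%:R) =
  sigma / c%:R * (2 ^+ size (primes c) + 2) + c%:R * 0 by ring.
have strip_le k : k%:R / c%:R <= strip_end sigma y (c, k).
  by rewrite /strip_end/= lerDl divr_ge0 ?mulr_ge0 ?(ltW s0) ?(ltW y0) ?(ltW cR).
have k0 k : 0 <= k%:R / c%:R :> R by rewrite divr_ge0.
have ysc : y * (sigma / (c%:R * y)) = sigma / c%:R by field; rewrite !gt_eqF.
apply: row => //; first by rewrite sc0 lexx.
- move=> k kc _; rewrite mulr_ge0 ?itv_measure_ge0 ?(ltW y0)//= -ysc. rewrite ler_pM2l//.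
  by apply: le_trans (itv_measure_le _ (strip_le k)) _ => //; rewrite /strip_end/= addrAC subrr add0r.
- move=> k kc _ cbk; rewrite itv_measure_itv0// max_l ?mulr0//.
  by rewrite subr_le0 ge_min; apply/orP; right; rewrite ler_pdivlMr// mulrC.
move=> k kc _ kcb; rewrite itv_measure_itv0// min_l; last first.
  rewrite /strip_end/= (le_trans (_ : _ <= k.+1%:R / c%:R))//; last first.
    by rewrite ler_pdivrMr// mulrC.
  rewrite -natr1 mulrDl lerD2l mul1r -(ler_pM2l y0) ysc.
  by rewrite ler_pM2r ?invr_gt0.
rewrite max_r ?subr_ge0// /strip_end/= addrAC subrr add0r ysc.
by rewrite subrr normr0.
Qed.

End equidistribution.

(** * Equidistribution of the strips *)

Section equidistribution_borel.
Context (R : realType).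
Local Notation mu := (@lebesgue_measure R).
Implicit Types (T : set (measurableTypeR R)).

Lemma eq_itv_measure T T' (a b : R) :
  (forall t, a < t <= b -> (T t <-> T' t)) -> itv_measure T a b = itv_measure T' a b.
Proof.
move=> TT'; congr (fine (mu _)); apply/seteqP; split=> t [Tt /[dup] h];
  by rewrite /= in_itv/= => tab; split=> //; apply/(TT' t tab).
Qed.

Lemma itv_measure_setU T T' (a b : R) : measurable T -> measurable T' ->
  T `&` T' = set0 -> itv_measure (T `|` T') a b = itv_measure T a b + itv_measure T' a b.
Proof.
move=> mT mT' dis; apply: EFin_inj; rewrite EFinD -!itv_measureE//; last exact: measurableU.
rewrite setIUl measureU//; [exact: measurable_setI_itvoc..|].
by rewrite setIACA dis set0I.
Qed.

Lemma itv_measure_setC T (a b : R) : measurable T -> a <= b ->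
  itv_measure (~` T) a b = b - a - itv_measure T a b.
Proof.
move=> mT ab; have mTC : measurable (~` T : set (measurableTypeR R)) by exact: measurableC.
have := @itv_measure_setU T (~` T) a b mT mTC (setICr T).
rewrite setUv {1}/itv_measure setTI lebesgue_itvoc//= => ->.
by rewrite addrAC subrr add0r.
Qed.

Definition strip_discrepancy (eps y : R) (n : nat) T : R :=
  strip_sum n.+1 (eps / n.+1%:R) y T - eps * farey_density R n * itv_measure T 0 1.

Lemma strip_sum_ge0 (N : nat) (sigma y : R) T : 0 <= y ->
  0 <= strip_sum N sigma y T.
Proof. by move=> y0; apply: sumr_ge0 => i _; rewrite mulr_ge0 ?itv_measure_ge0. Qed.

Lemma strip_sum_setU (N : nat) (sigma y : R) T T' : measurable T -> measurable T' ->
  T `&` T' = set0 ->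
  strip_sum N sigma y (T `|` T') = strip_sum N sigma y T + strip_sum N sigma y T'.
Proof.
move=> mT mT' dis; rewrite /strip_sum -big_split/=; apply: eq_bigr => i _.
by rewrite itv_measure_setU// mulrDr.
Qed.

Section fixed_height.
Variables (eps y : R).
Hypotheses (eps0 : 0 < eps) (epsy : eps <= y).
Local Notation D := (strip_discrepancy eps y).

Let y0 : 0 < y := lt_le_trans eps0 epsy.

Let sigma0 n : 0 < eps / n.+1%:R.
Proof. by rewrite divr_gt0. Qed.

Let Nsigma n : n.+1%:R * (eps / n.+1%:R) = eps.
Proof. by rewrite mulrC divfK. Qed.

(** This bound is uniform in [n]: it is what lets the convergence below pass to
    countable unions. *)
Lemma strip_discrepancy_bound n T : measurable T ->
  `|D n T| <= y * itv_measure T 0 1.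
Proof.
move=> mT; have := @strip_sum_le R n.+1 (eps / n.+1%:R) y T mT y0 (sigma0 n).
rewrite Nsigma => /(_ epsy); have := @strip_sum_ge0 n.+1 (eps / n.+1%:R) y T (ltW y0).
have /andP[K0 K1] := farey_density_bounds R n.
have {}K0 : 0 <= farey_density R n by apply: le_trans K0; rewrite invr_ge0.
have l0 : 0 <= itv_measure T 0 1 by exact: itv_measure_ge0.
have : 0 <= eps * farey_density R n * itv_measure T 0 1 <= y * itv_measure T 0 1.
  apply/andP; split; first exact: (mulr_ge0 (mulr_ge0 (ltW eps0) K0) l0).
  by apply: ler_wpM2r => //; rewrite -[leRHS]mulr1 ler_pM// ltW.
rewrite /strip_discrepancy => /andP[? ?] ? ?; rewrite ler_norml.
by apply/andP; split; lra.
Qed.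

Lemma strip_discrepancy_setU n T T' : measurable T -> measurable T' ->
  T `&` T' = set0 -> D n (T `|` T') = D n T + D n T'.
Proof.
move=> mT mT' dis; rewrite /strip_discrepancy strip_sum_setU// itv_measure_setU//.
by ring.
Qed.

(** All the strips lie over the unit interval of slopes. *)
Lemma eq_strip_discrepancy n T T' :
  (forall t, 0 < t <= 1 -> (T t <-> T' t)) -> D n T = D n T'.
Proof.
move=> TT'; congr (_ - _ * _); last exact: eq_itv_measure.
rewrite /strip_sum big_seq [RHS]big_seq; apply: eq_bigr => -[c k].
rewrite mem_farey => /and3P[/andP[c0 cN] kc _]; congr (_ * _).
apply: eq_itv_measure => t; rewrite -[_ && _]/(t \in `]_, _]) in_strip// => /andP[s0 s1].
have cR : 0 < c%:R :> R by rewrite ltr0n.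
move: s0; rewrite pmulr_lgt0// subr_gt0 => kct; apply: TT'.
have kc' : k%:R + 1 <= c%:R :> R by rewrite natr1 ler_nat.
have k0 : 0 <= k%:R :> R by [].
rewrite -(pmulr_rgt0 _ cR) (le_lt_trans k0 kct)/=.
rewrite -(ler_pM2l cR) mulr1 (le_trans _ kc')// -lerBlDl -(ler_pM2r y0) mul1r.
rewrite (le_trans s1)// (le_trans _ epsy)// ler_pdivrMr// ler_peMr ?(ltW eps0)//.
by rewrite ler1n.
Qed.

Lemma cvg_strip_discrepancy_ray b :
  D n `]-oo, b]%classic @[n --> \oo] --> 0.
Proof.
pose b' := Num.max 0 (Num.min 1 b).
have b'01 : 0 <= b' <= 1.
  by rewrite /b' le_max lexx/= ge_max ler01/= ge_min lexx.
have E n : D n `]-oo, b]%classic = D n `]0, b']%classic.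
  apply: eq_strip_discrepancy => t /andP[t0 t1]; rewrite /= !in_itv/= t0/=.
  by rewrite le_max (leNgt t 0) t0/= le_min t1.
apply/cvgr0Pnorm_lt => e e0.
have /cvgr0Pnorm_lt/(_ (e / eps) (divr_gt0 e0 eps0)) := @cvg_farey_err R.
apply: filterS => n lte; rewrite E.
have := @strip_sum_itv R n (eps / n.+1%:R) y b' b'01 (sigma0 n).
rewrite Nsigma /strip_discrepancy itv_measure_itv0// subr0.
have -> : Num.max 0 (Num.min 1 b') = b'.
  by case/andP: b'01 => b0 b1; rewrite min_r// max_r.
rewrite [eps * _ * b']mulrAC => /(_ _) /le_lt_trans; apply.
  by apply: le_trans epsy; rewrite ler_pdivrMr// ler_peMr ?(ltW eps0)// ler1n.
rewrite mulrC -ltr_pdivlMr//; exact: le_lt_trans (ler_norm _) lte.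
Qed.

(** Equidistribution of the strips. The sets for which it holds form a Dynkin
    class; it contains the intervals by the count of coprime integers, hence all
    Borel sets. *)
Lemma cvg_strip_discrepancy T : measurable T -> D n T @[n --> \oo] --> 0.
Proof.
have mray b : measurable (`]-oo, b]%classic : set (measurableTypeR R)) by [].
apply: (@dynkin_induction _ (measurableTypeR R) (@ocitv R)
  [set T | D n T @[n --> \oo] --> 0]) => //.
- exact: ocitvI.
- rewrite /=; suff -> : (fun n => D n setT) = (fun n => D n `]-oo, 1]%classic).
    exact: cvg_strip_discrepancy_ray.
  apply/funext => n; apply: eq_strip_discrepancy => t /andP[_ t1].
  by rewrite /= in_itv/= t1.
- move=> _ [[a b] _ <-] /=; have [ab|ba] := leP a b; last first.
    rewrite set_itv_ge; last by rewrite -leNgt bnd_simp ltW.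
    suff -> : (fun n => D n set0) = cst 0 by exact: cvg_cst.
    apply/funext => n; apply/eqP; rewrite -normr_eq0 eq_le normr_ge0 andbT.
    apply: le_trans (strip_discrepancy_bound _ _) _ => //.
    by rewrite /itv_measure set0I measure0 mulr0.
  have -> : (fun n => D n `]a, b]%classic) =
      (fun n => D n `]-oo, b]%classic - D n `]-oo, a]%classic).
    apply/funext => n; apply/eqP; rewrite eq_sym subr_eq addrC; apply/eqP.
    rewrite -strip_discrepancy_setU//; last first.
      apply/seteqP; split=> // t [] /=; rewrite !in_itv/= => ta /andP[+ _].
      by rewrite ltNge ta.
    congr (D n _); apply/seteqP; split=> t /=; rewrite !in_itv/=.
      by move=> tb; have [ta|ta] := leP t a; [left|right].
    by move=> [ta|/andP[_ //]]; exact: le_trans ab.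
  by rewrite -(subr0 0); apply: cvgB; exact: cvg_strip_discrepancy_ray.
- move=> S mS DS /=.
  have -> : (fun n => D n (~` S)) = (fun n => D n `]-oo, 1]%classic - D n S).
    apply/funext => n; apply/eqP; rewrite eq_sym subr_eq addrC; apply/eqP.
    rewrite -strip_discrepancy_setU ?setUv ?setICr//; last exact: measurableC.
    by apply: eq_strip_discrepancy => t /andP[_ t1]; rewrite /= in_itv/= t1.
  by rewrite -(subr0 0); apply: cvgB => //; exact: cvg_strip_discrepancy_ray.
move=> F mF tF DF /=; set U := \bigcup_k F k.
have mU : measurable U by exact: bigcup_measurable.
pose H m := \big[setU/set0]_(i < m) F i.
have mH m : measurable (H m : set (measurableTypeR R)).
  by apply: bigsetU_measurable.
have DH m : D n (H m) @[n --> \oo] --> 0.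
  elim: m => [|m IH].
    rewrite /H big_ord0.
    suff -> : (fun n => D n set0) = cst 0 by exact: cvg_cst.
    apply/funext => n; apply/eqP; rewrite -normr_eq0 eq_le normr_ge0 andbT.
    apply: le_trans (strip_discrepancy_bound _ _) _ => //.
    by rewrite /itv_measure set0I measure0 mulr0.
  have -> : (fun n => D n (H m.+1)) = (fun n => D n (H m) + D n (F m)).
    apply/funext => n; have -> : H m.+1 = H m `|` F m by rewrite /H big_ord_recr.
    rewrite strip_discrepancy_setU//.
    apply/seteqP; split=> // t [] /=; rewrite /H -bigcup_mkord => -[i im Fit] Fmt.
    have E : i = m := tF i m Logic.I Logic.I (ex_intro _ t (conj Fit Fmt)).
    by move: im; rewrite /= E ltnn.
  by rewrite -(addr0 0); exact: (cvgD IH (DF m)).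
have tail m : itv_measure U 0 1 = itv_measure (H m) 0 1 + itv_measure (U `\` H m) 0 1.
  rewrite -itv_measure_setU ?setDIK//; last exact: measurableD.
  by congr itv_measure; rewrite setDUK//; exact: bigsetU_bigcup.
have cvgH : itv_measure (H m) 0 1 @[m --> \oo] --> itv_measure U 0 1.
  pose G m := H m `&` `]0, 1]%classic : set (measurableTypeR R).
  have UG : \bigcup_m G m = U `&` `]0, 1]%classic.
    rewrite -setI_bigcupl; congr (_ `&` _); apply/seteqP; split=> t.
      by move=> [m _]; exact: bigsetU_bigcup.
    by move=> [k _ Fkt]; exists k.+1 => //; rewrite /H -bigcup_mkord; exists k => /=.
  rewrite {2}/itv_measure -UG; apply: fine_cvg; rewrite fineK; last by rewrite UG itv_measureE.
  apply: nondecreasing_cvg_mu.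
  - by move=> m; exact: measurable_setI_itvoc.
  - by rewrite UG; exact: measurable_setI_itvoc.
  - move=> m n mn; apply/subsetPset; apply: setSI; exact: subset_bigsetU.
apply/cvgr0Pnorm_lt => e e0; have e2 : 0 < e / 2 by rewrite divr_gt0.
have /cvgrPdist_lt/(_ (e / 2 / y) (divr_gt0 e2 y0))/filter_ex[m Hm] := cvgH.
have /cvgr0Pnorm_lt/(_ _ e2) := DH m.
apply: filterS => n lte.
have -> : U = H m `|` (U `\` H m) by rewrite setDUK//; exact: bigsetU_bigcup.
have mD : measurable (U `\` H m) by exact: measurableD.
rewrite strip_discrepancy_setU ?setDIK//.
apply: le_lt_trans (ler_normD _ _) _; rewrite [e]splitr ltrD//.
apply: le_lt_trans (strip_discrepancy_bound _ mD) _.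
rewrite mulrC -ltr_pdivlMr//; apply: le_lt_trans Hm.
by rewrite (tail m) addrAC subrr add0r ger0_norm ?itv_measure_ge0.
Qed.

End fixed_height.
End equidistribution_borel.

(** * Integrals of bounded functions over intervals *)

Section interval_integral.
Context (R : realType).
Local Notation mu := (@lebesgue_measure R).
Implicit Types (f g : R -> R) (p q a b : R).

Definition itv_int f p q : R := \int[mu]_(x in `]p, q]%classic) f x.

Definition itv_bounded f p q : Prop :=
  measurable_fun `]p, q]%classic f /\
  exists M, forall x, p < x <= q -> `|f x| <= M.

Lemma itv_bounded_integrable f p q : itv_bounded f p q ->
  mu.-integrable `]p, q]%classic (EFin \o f).
Proof.
move=> [mf [M fM]]; apply: measurable_bounded_integrable => //.
  by rewrite /= lebesgue_measure_itv/=; case: ifP => // _; rewrite ltry.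
exists M; split; first exact: num_real.
by move=> K MK x /=; rewrite in_itv/= => /fM /le_trans; apply; exact: ltW.
Qed.

Lemma itv_boundedB f g p q : itv_bounded f p q -> itv_bounded g p q ->
  itv_bounded (fun x => f x - g x) p q.
Proof.
move=> [mf [M fM]] [mg [N gN]]; split; first exact: measurable_funB.
exists (M + N) => x xpq; apply: le_trans (ler_normB _ _) _.
by rewrite lerD ?fM ?gN.
Qed.

Lemma itv_boundedZ f p q r : itv_bounded f p q ->
  itv_bounded (fun x => r * f x) p q.
Proof.
move=> [mf [M fM]]; split; first exact: measurable_funM.
by exists (`|r| * M) => x xpq; rewrite normrM ler_wpM2l ?fM.
Qed.

Lemma itv_bounded_sum (I : Type) (s : seq I) (h : I -> R -> R) p q :
  (forall i, itv_bounded (h i) p q) ->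
  itv_bounded (fun x => \sum_(i <- s) h i x) p q.
Proof.
move=> hb; split.
  by apply: measurable_sum => i; exact: (hb i).1.
elim: s => [|i s [M IH]].
  by exists 0 => x _; rewrite big_nil normr0.
have [_ [N hN]] := hb i; exists (N + M) => x xpq; rewrite big_cons.
by apply: le_trans (ler_normD _ _) _; rewrite lerD ?hN ?IH.
Qed.

Lemma eq_itv_int f g p q : (forall x, p < x <= q -> f x = g x) ->
  itv_int f p q = itv_int g p q.
Proof. by move=> fg; apply: eq_Rintegral => x; rewrite inE/= in_itv => /fg. Qed.

Lemma eq_itv_bounded f g p q : (forall x, p < x <= q -> f x = g x) ->
  itv_bounded f p q -> itv_bounded g p q.
Proof.
move=> fg [mf [M fM]]; split.
  by apply: eq_measurable_fun mf => x; rewrite inE/= in_itv => /fg.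
by exists M => x xpq; rewrite -fg// fM.
Qed.

Lemma itv_intB f g p q : itv_bounded f p q -> itv_bounded g p q ->
  itv_int (fun x => f x - g x) p q = itv_int f p q - itv_int g p q.
Proof. by move=> fb gb; apply: RintegralB => //; exact: itv_bounded_integrable. Qed.

Lemma itv_intZ f p q r : itv_bounded f p q ->
  itv_int (fun x => r * f x) p q = r * itv_int f p q.
Proof. by move=> fb; apply: RintegralZl => //; exact: itv_bounded_integrable. Qed.

Lemma itv_int_sum (I : Type) (s : seq I) (h : I -> R -> R) p q :
  (forall i, itv_bounded (h i) p q) ->
  itv_int (fun x => \sum_(i <- s) h i x) p q = \sum_(i <- s) itv_int (h i) p q.
Proof.
move=> hb; elim: s => [|i s IH].
  rewrite big_nil -[RHS](mul0r (itv_int (fun=> 0) p q)) -itv_intZ.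
    by apply: eq_itv_int => x _; rewrite big_nil mulr0.
  by split; [exact: measurable_cst|exists 0 => x _; rewrite normr0].
rewrite big_cons -IH -RintegralD//; try exact: itv_bounded_integrable.
  by apply: eq_itv_int => x _; rewrite big_cons.
by apply: itv_bounded_integrable; exact: itv_bounded_sum.
Qed.

Lemma itv_int_norm_le f p q M : p <= q -> itv_bounded f p q ->
  (forall x, p < x <= q -> `|f x| <= M) -> `|itv_int f p q| <= M * (q - p).
Proof.
move=> pq fb fM; have fi := itv_bounded_integrable fb.
apply: le_trans (le_normr_Rintegral _ fi) _ => //.
have -> : M * (q - p) = \int[mu]_(x in `]p, q]%classic) M.
  by rewrite Rintegral_cst//= lebesgue_itvoc.
apply: le_Rintegral => //.
- apply: (@itv_bounded_integrable (fun x => `|f x|)); split.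
    by apply: measurableT_comp => //; exact: fb.1.
  by exists M => x xpq; rewrite normr_id fM.
by apply: (@itv_bounded_integrable (fun=> M)); split=> //; exists `|M|.
Qed.

Lemma itv_int_dist_le f g p q e : p <= q ->
  itv_bounded f p q -> itv_bounded g p q ->
  (forall x, p < x <= q -> `|f x - g x| <= e) ->
  `|itv_int f p q - itv_int g p q| <= e * (q - p).
Proof.
move=> pq fb gb fg; rewrite -itv_intB//; apply: itv_int_norm_le => //.
exact: itv_boundedB.
Qed.

Lemma itv_int_ge0 f p q : (forall x, p < x <= q -> 0 <= f x) ->
  0 <= itv_int f p q.
Proof. by move=> f0; apply: Rintegral_ge0 => x; rewrite /= in_itv => /f0. Qed.

(** Bounded convergence. *)
Lemma cvg_itv_int0 (f : nat -> R -> R) p q M : p <= q ->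
  (forall n, measurable_fun `]p, q]%classic (f n)) ->
  (forall n x, p < x <= q -> `|f n x| <= M) ->
  (forall x, p < x <= q -> f n x @[n --> \oo] --> 0) ->
  itv_int (f n) p q @[n --> \oo] --> 0.
Proof.
move=> pq mf fM f0.
have [||||||_ _] := @dominated_convergence _ _ R mu `]p, q]%classic _
  (fun n x => (f n x)%:E) (cst 0%E) (cst M%:E).
- by [].
- by move=> n; apply/measurable_EFinP; exact: mf.
- exact: measurable_cst.
- apply: aeW => x; rewrite /= in_itv => /f0 h.
  by apply: cvg_EFin => //; exact: nearW.
- by apply: (@itv_bounded_integrable (fun=> M)); split=> //; exists `|M|.
- by apply: aeW => x n; rewrite /= in_itv => /(fM n); rewrite lee_fin.
rewrite integral0 => /fine_cvg; exact.
Qed.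

Lemma itv_measure_xsection_bounded (Z : set (measurableTypeR R * measurableTypeR R)) a b p q :
  measurable Z -> itv_bounded (fun y => itv_measure (xsection Z y) a b) p q.
Proof.
move=> mZ; split; last first.
  exists `|b - a| => y _; rewrite ger0_norm ?itv_measure_ge0//.
  have [ab|ba] := leP a b.
    by rewrite ger0_norm ?subr_ge0// itv_measure_le//; exact: measurable_xsection.
  suff -> : itv_measure (xsection Z y) a b = 0 by [].
  by rewrite /itv_measure set_itv_ge ?setI0 ?measure0// -leNgt bnd_simp ltW.
have -> : (fun y => itv_measure (xsection Z y) a b) =
    fine \o (mu \o xsection (Z `&` (setT `*` `]a, b]%classic))).
  apply/funext => y /=; congr (fine (mu _)); apply/seteqP; split=> t.
    by move=> [Zt abt]; rewrite xsectionE; split=> //; rewrite xsectionE in Zt.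
  by rewrite xsectionE => -[Zt [_ abt]]; split; rewrite ?xsectionE.
apply: measurableT_comp => //; apply: measurable_funS (measurable_fun_xsection _ _) => //.
by apply: measurableI => //; exact: measurableX.
Qed.

Lemma itv_int_tonelli (Z : set (measurableTypeR R * measurableTypeR R)) a b p q :
  measurable Z ->
  itv_int (fun y => itv_measure (xsection Z y) a b) p q =
  itv_int (fun s => itv_measure (ysection Z s) p q) a b.
Proof.
move=> mZ; pose Z' := Z `&` (`]p, q]%classic `*` `]a, b]%classic).
have mZ' : measurable Z' by apply: measurableI => //; exact: measurableX.
have E : (\int[mu]_y (mu \o xsection Z') y = \int[mu]_s (mu \o ysection Z') s)%E.
  apply: (@product_measure_unique _ _ _ _ R mu mu (mu \x^ mu)%E) => // B C mB mC /=.
  by rewrite product_measure2E.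
rewrite /itv_int /Rintegral; congr fine.
transitivity (\int[mu]_x (mu \o xsection Z') x)%E; last rewrite E.
  rewrite integral_mkcond; apply: eq_integral => y _ /=; rewrite patchE.
  case: ifPn => [/set_mem ypq|/negP ypq].
    rewrite -itv_measureE; last exact: measurable_xsection.
    congr (mu _); apply/seteqP; split=> t; rewrite ?xsectionE.
      by move=> [Zt abt]; split.
    by move=> [Zt [_ abt]]; split; rewrite ?xsectionE.
  rewrite (_ : xsection Z' y = set0) ?measure0//.
  by apply/seteqP; split=> // t; rewrite xsectionE => -[_ [ypq' _]]; apply: ypq; rewrite inE.
rewrite [RHS]integral_mkcond; apply: eq_integral => s _ /=; rewrite patchE.
case: ifPn => [/set_mem sab|/negP sab].
  rewrite -itv_measureE; last exact: measurable_ysection.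
  congr (mu _); apply/seteqP; split=> t; rewrite ?ysectionE.
    by move=> [Zt [abt _]]; split; rewrite ?ysectionE.
  by move=> [Zt abt]; split.
rewrite (_ : ysection Z' s = set0) ?measure0//.
by apply/seteqP; split=> // t; rewrite ysectionE => -[_ [_ sab']]; apply: sab; rewrite inE.
Qed.

End interval_integral.

(** * Invariant sets of the plane in strips *)

Section slope_coordinates.
Context (R : realType).
Local Notation mu := (@lebesgue_measure R).
Local Notation R2 := (measurableTypeR R * measurableTypeR R)%type.

Definition SL2Z_invariant (A : set R2) : Prop :=
  forall a b c d : int, a * d - b * c = 1 -> forall x y : R,
    A (a%:~R * x + b%:~R * y, c%:~R * x + d%:~R * y) <-> A (x, y).

(** The set [A] in the coordinates [(y, t)], where [t = x / y] is the slope. In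
    these coordinates the translations [(x, y) |-> (x + m y, y)] act by
    [t |-> t + m], so the sections of an invariant set at a given height are
    1-periodic. *)
Definition slopes (A : set R2) : set R2 := [set z | A (z.2 * z.1, z.1)].

(** The part of [A] with slopes in [`]0, b]`], in the coordinates [(y, s)] where
    [s = c x - k y]. *)
Definition strip_preimage (A : set R2) (c k : nat) (b : R) : set R2 :=
  [set z | A ((z.2 + k%:R * z.1) / c%:R, z.1) /\
           0 < z.2 + k%:R * z.1 <= b * (c%:R * z.1)].

Lemma measurable_slopes (A : set R2) : measurable A -> measurable (slopes A).
Proof.
move=> mA; rewrite -[X in measurable X]setTI.
apply: (_ : measurable_fun setT (fun z : R2 => (z.2 * z.1, z.1) : R2)) => //.
by apply: measurable_fun_pair => //; exact: measurable_funM.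
Qed.

Lemma measurable_strip_preimage (A : set R2) c k b :
  measurable A -> measurable (strip_preimage A c k b).
Proof.
move=> mA.
have mlin : measurable_fun setT (fun z : R2 => z.2 + k%:R * z.1 : measurableTypeR R).
  apply: measurable_funD => //; exact: measurable_funM.
apply: measurableI.
  rewrite -[X in measurable X]setTI.
  apply: (_ : measurable_fun setT (fun z : R2 =>
     ((z.2 + k%:R * z.1) / c%:R, z.1) : R2)) => //.
  by apply: measurable_fun_pair => //; exact: measurable_funM.
pose f (z : R2) : R2 := (z.2 + k%:R * z.1, b * (c%:R * z.1) - (z.2 + k%:R * z.1)).
have mf : measurable_fun setT f.
  apply: measurable_fun_pair => //; apply: measurable_funB => //.
  by apply: measurable_funM => //; exact: measurable_funM.
have := mf measurableT (`]0, +oo[%classic `*` `[0, +oo[%classic).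
rewrite setTI => /(_ _); rewrite (_ : f @^-1` _ = [set z | 0 < z.2 + k%:R * z.1 <= b * (c%:R * z.1)]).
  by apply; exact: measurableX.
apply/seteqP; split=> z /=; rewrite !in_itv/= !andbT subr_ge0.
  by move=> [-> ->].
by move=> /andP[-> ->].
Qed.

Section strips.
Variable A : set R2.
Hypothesis mA : measurable A.
Local Notation S y := (xsection (slopes A) y).

Let mS y : measurable (S y : set (measurableTypeR R)).
Proof. by apply: measurable_xsection; exact: measurable_slopes. Qed.

Lemma in_slope (y t : R) : S y t <-> A (t * y, y).
Proof. by rewrite xsectionP. Qed.

Lemma strip_measure_preimage (c k : nat) (b sigma y : R) : (0 < c)%N -> 0 < y ->
  y * itv_measure (S y `&` `]0, b]%classic) (k%:R / c%:R) (strip_end sigma y (c, k)) =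
  c%:R^-1 * itv_measure (xsection (strip_preimage A c k b) y) 0 sigma.
Proof.
move=> c0 y0; have cR : 0 < c%:R :> R by rewrite ltr0n.
have cy : 0 < c%:R * y by rewrite mulr_gt0.
have -> : xsection (strip_preimage A c k b) y =
    (fun s : R => (c%:R * y)^-1 * s + k%:R / c%:R) @^-1` (S y `&` `]0, b]%classic).
  apply/seteqP; split=> s.
    move=> /xsectionP[/= As /andP[s0 sb]]; split=> /=.
      apply/in_slope; move: As; congr (A (_, _)); field.
      by rewrite !gt_eqF.
    rewrite in_itv/=; have -> : (c%:R * y)^-1 * s + k%:R / c%:R = (s + k%:R * y) / (c%:R * y).
      by field; rewrite !gt_eqF.
    by rewrite divr_gt0//= ler_pdivrMr.
  move=> [/= /in_slope As]; rewrite in_itv/=.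
  have -> : (c%:R * y)^-1 * s + k%:R / c%:R = (s + k%:R * y) / (c%:R * y).
    by field; rewrite !gt_eqF.
  rewrite pmulr_lgt0 ?invr_gt0// ler_pdivrMr// => sb; apply/xsectionP; split=> //=.
  by move: As; congr (A (_, _)); field; rewrite !gt_eqF.
rewrite itv_measure_affine ?invr_gt0//; last exact: measurableI.
rewrite invrK mulr0 add0r /strip_end/= [X in itv_measure _ _ X]addrC [_ * sigma]mulrC.
by field; rewrite gt_eqF.
Qed.

(** As [y] is the Jacobian of [(y, t) |-> (t y, y)], this is an area in the plane. *)
Definition strip_integral (c k : nat) (b sigma p q : R) : R :=
  itv_int (fun y => y * itv_measure (S y `&` `]0, b]%classic)
    (k%:R / c%:R) (strip_end sigma y (c, k))) p q.

Lemma strip_integrand_bounded (c k : nat) (b sigma p q : R) : (0 < c)%N -> 0 <= p ->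
  itv_bounded (fun y => y * itv_measure (S y `&` `]0, b]%classic)
    (k%:R / c%:R) (strip_end sigma y (c, k))) p q.
Proof.
move=> c0 p0; apply: (@eq_itv_bounded _ (fun y => c%:R^-1 *
    itv_measure (xsection (strip_preimage A c k b) y) 0 sigma)).
  by move=> y /andP[py _]; rewrite strip_measure_preimage// (le_lt_trans p0).
apply/itv_boundedZ/itv_measure_xsection_bounded; exact: measurable_strip_preimage.
Qed.

Lemma strip_integral_bounds (c k : nat) (b sigma p q : R) : (0 < c)%N ->
  0 <= p <= q -> 0 < sigma ->
  0 <= strip_integral c k b sigma p q <= (q - p) * (sigma / c%:R).
Proof.
move=> c0 /andP[p0 pq] s0; have cR : 0 < c%:R :> R by rewrite ltr0n.
have F0 y : p < y <= q -> 0 <= y * itv_measure (S y `&` `]0, b]%classic)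
    (k%:R / c%:R) (strip_end sigma y (c, k)).
  by move=> /andP[py _]; rewrite mulr_ge0 ?itv_measure_ge0// ltW// (le_lt_trans p0).
rewrite itv_int_ge0//= mulrC; apply: le_trans (ler_norm _) _.
apply: itv_int_norm_le => //; first exact: strip_integrand_bounded.
move=> y /[dup] ypq /F0 /ger0_norm ->; move: ypq => /andP[py yq].
have y0 : 0 < y by rewrite (le_lt_trans p0).
rewrite -ler_pdivlMl//; apply: le_trans (itv_measure_le _ _) _.
- exact: measurableI.
- by rewrite /strip_end/= lerDl divr_ge0 ?mulr_ge0 ?(ltW s0) ?(ltW y0) ?(ltW cR).
rewrite /strip_end/= addrAC subrr add0r le_eqVlt; apply/orP; left; apply/eqP.
by field; rewrite !gt_eqF.
Qed.

Lemma strip_integral0 (c k : nat) (b sigma p q : R) : (0 < c)%N ->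
  c%:R * b <= k%:R -> strip_integral c k b sigma p q = 0.
Proof.
move=> c0 cbk; have cR : 0 < c%:R :> R by rewrite ltr0n.
rewrite /strip_integral (@eq_itv_int _ _ (fun=> 0)).
  by rewrite /itv_int Rintegral_cst//= mul0r.
move=> y _; rewrite (@eq_itv_measure _ _ set0).
  by rewrite /itv_measure set0I measure0 mulr0.
move=> t /andP[kt _]; split=> // -[_]; rewrite /= in_itv/= => /andP[_].
by rewrite leNgt (le_lt_trans _ kt)// ler_pdivlMr// mulrC.
Qed.

Hypothesis invA : SL2Z_invariant A.

Lemma slope_periodic (y t : R) : S y (t + 1) <-> S y t.
Proof.
rewrite !in_slope; have := @invA 1 1 0 1 erefl (t * y) y.
by rewrite mul0r add0r !mul1r mulrDl mul1r.
Qed.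

(** Along the line [c x - k y = s], the invariant set [A] looks like its section at
    height [s]: a matrix of SL(2, Z) with second row [(c, - k)] maps this line to
    the horizontal line of height [s], on which [A] has period [s]. Since the
    coordinate [y] decreases by [c * s] over one period, the error is of this
    order. *)
Lemma strip_line_measure (c k : nat) (s p q : R) : (0 < c)%N -> coprime k c ->
  0 < s -> p <= q ->
  `|itv_measure [set y | A ((s + k%:R * y) / c%:R, y)] p q - (q - p) * itv_measure (S s) 0 1|
    <= 2 * (c%:R * s).
Proof.
move=> c0 kc s0 pq; have cR : 0 < c%:R :> R by rewrite ltr0n.
have cs0 : 0 < c%:R * s by rewrite mulr_gt0.
(* (a, d) is the first row of the matrix, given by a Bezout relation. *)
have [a [d Ead]] : exists a d : int, - (a * k%:Z) - d * c%:Z = 1.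
  have [u [v Euv]] := Bezoutz k%:Z c%:Z.
  by exists (- u), (- v); rewrite !mulNr !opprK Euv /gcdz !absz_nat (eqP kc).
have ER : - (a%:~R * k%:R) - d%:~R * c%:R = 1 :> R.
  by have := congr1 (fun z : int => z%:~R : R) Ead; rewrite intrB intrN !intrM.
have -> : [set y | A ((s + k%:R * y) / c%:R, y)] =
    (fun y : R => (- (c%:R * s)^-1) * y + a%:~R / c%:R) @^-1` (S s).
  apply/seteqP; suff H y : A ((s + k%:R * y) / c%:R, y) <->
      S s ((- (c%:R * s)^-1) * y + a%:~R / c%:R) by split=> y /=; apply H.
  rewrite in_slope -(@invA a d c%:Z (- k%:Z)); last by rewrite mulrN.
  have -> : a%:~R * ((s + k%:R * y) / c%:R) + d%:~R * y =
      (- (c%:R * s)^-1 * y + a%:~R / c%:R) * s.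
    have -> : d%:~R = (- 1 - a%:~R * k%:R) / c%:R :> R.
      have dc : d%:~R * c%:R = - 1 - a%:~R * k%:R :> R by lra.
      by rewrite -dc mulfK ?gt_eqF.
    by field; rewrite !gt_eqF.
  have -> : c%:Z%:~R * ((s + k%:R * y) / c%:R) + (- k%:Z)%:~R * y = s.
    by rewrite intrN -!pmulrn; field; rewrite gt_eqF.
  by [].
rewrite itv_measure_affineN ?oppr_lt0 ?invr_gt0// opprK invrK.
set u := _ * q + _; set v := _ * p + _.
have vu : v - u = (q - p) / (c%:R * s).
  by rewrite /u /v; field; rewrite !gt_eqF.
have uv : u <= v by rewrite -subr_ge0 vu divr_ge0 ?subr_ge0// ltW.
have := @itv_measure_periodic R (S s) 1 u v (mS s) ltr01 uv (slope_periodic s).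
rewrite divr1 mulr1 vu => h.
have -> : c%:R * s * itv_measure (S s) u v - (q - p) * itv_measure (S s) 0 1 =
  c%:R * s * (itv_measure (S s) u v - (q - p) / (c%:R * s) * itv_measure (S s) 0 1).
  by field; rewrite !gt_eqF.
by rewrite normrM (gtr0_norm cs0) mulrC ler_pM2r.
Qed.

(** The mass, for [ds dt], of one period of [A] in the strip [0 < s <= sigma]. It is
    the same for all the strips. *)
Definition slope_mass (sigma : R) : R := itv_int (fun s => itv_measure (S s) 0 1) 0 sigma.

Lemma slope_mass_bounds (sigma : R) : 0 <= sigma -> 0 <= slope_mass sigma <= sigma.
Proof.
move=> s0; rewrite /slope_mass itv_int_ge0/=; last by move=> s _; exact: itv_measure_ge0.
apply: le_trans (ler_norm _) _; rewrite -[leRHS]mul1r -{2}[sigma]subr0.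
apply: itv_int_norm_le => //.
  by apply: itv_measure_xsection_bounded; exact: measurable_slopes.
by move=> s _; rewrite ger0_norm ?itv_measure_ge0// -{2}[1]subr0 itv_measure_le.
Qed.

(** By Tonelli the strip can be cut along the lines [c x - k y = s], on which
    [strip_line_measure] applies. *)
Lemma strip_integral_full (c k : nat) (b sigma p q : R) : (0 < c)%N ->
  coprime k c -> 0 < sigma <= p -> p <= q -> k.+1%:R <= c%:R * b ->
  `|strip_integral c k b sigma p q - (q - p) / c%:R * slope_mass sigma|
    <= 2 * sigma ^+ 2.
Proof.
move=> c0 kc /andP[s0 sp] pq kcb; have cR : 0 < c%:R :> R by rewrite ltr0n.
have p0 : 0 < p := lt_le_trans s0 sp.
have mZ := @measurable_strip_preimage A c k b mA.
have -> : strip_integral c k b sigma p q = c%:R^-1 *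
    itv_int (fun s => itv_measure (ysection (strip_preimage A c k b) s) p q) 0 sigma.
  rewrite -itv_int_tonelli// -itv_intZ; last exact: itv_measure_xsection_bounded.
  by apply: eq_itv_int => y /andP[py _]; rewrite strip_measure_preimage// (lt_trans p0).
rewrite [(q - p) / _]mulrC -mulrA -mulrBr normrM gtr0_norm ?invr_gt0//.
rewrite ler_pdivrMl// -itv_intZ; last first.
  by apply: itv_measure_xsection_bounded; exact: measurable_slopes.
have -> : c%:R * (2 * sigma ^+ 2) = 2 * (c%:R * sigma) * (sigma - 0) by ring.
apply: itv_int_dist_le; first exact: ltW.
- rewrite (_ : (fun s => _) = (fun s => itv_measure (xsection ((fun z : R2 => (z.2, z.1)) @^-1`
      strip_preimage A c k b) s) p q)).
    apply: itv_measure_xsection_bounded; rewrite -[X in measurable X]setTI.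
    by apply: (_ : measurable_fun setT (fun z : R2 => (z.2, z.1) : R2)) => //;
      apply: measurable_fun_pair.
  apply/funext => s; apply: eq_itv_measure => y _.
  by split=> [/ysectionP ?|/xsectionP ?]; [apply/xsectionP|apply/ysectionP].
- by apply/itv_boundedZ/itv_measure_xsection_bounded; exact: measurable_slopes.
move=> s /andP[s0' ssig].
rewrite (@eq_itv_measure _ _ [set y | A ((s + k%:R * y) / c%:R, y)]); last first.
  move=> y /andP[py yq]; split=> [/ysectionP[]//|As]; apply/ysectionP; split=> //=.
  have y0 : 0 < y by rewrite (lt_trans p0).
  have ky0 : 0 <= k%:R * y by rewrite mulr_ge0// ltW.
  apply/andP; split; first by rewrite ltr_pwDl.
  rewrite mulrA; apply: le_trans (_ : k.+1%:R * y <= _).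
    by rewrite -natr1 mulrDl mul1r addrC lerD2l (le_trans ssig)// (le_trans sp)// ltW.
  by rewrite ler_pM2r// mulrC.
apply: le_trans (strip_line_measure c0 kc s0' pq) _.
by rewrite ler_pM2l// ler_pM2l.
Qed.

(** The measure is [dy dt], for which the strips equidistribute, rather than the
    area [y dy dt]. *)
Definition slope_box (b p q : R) : R := itv_int (fun y => itv_measure (S y) 0 b) p q.

(** The mass of [A] in the strips over a box of slopes [`]0, b]`] and heights
    [`]p, q]`] is, up to [O(eps ^ 2)], the measure of the box for [dy dt] times
    a factor that depends on [A], [eps] and [n] only. The total mass of the strips has order [eps]. *)
Lemma strip_integral_sum (n : nat) (b eps p q : R) :
  0 <= b <= 1 -> 0 < eps <= p -> p <= q ->
  `|\sum_(i <- farey n.+1) strip_integral i.1 i.2 b (eps / n.+1%:R) p q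
    - (q - p) * b * (slope_mass (eps / n.+1%:R) * n.+1%:R * farey_density R n)|
  <= (q - p) * eps * farey_err R n + 2 * eps ^+ 2.
Proof.
move=> b01 /andP[e0 ep] pq; have /andP[b0 b1] := b01.
have N0 : 0 < n.+1%:R :> R by rewrite ltr0n.
set sigma := eps / n.+1%:R.
have s0 : 0 < sigma by rewrite divr_gt0.
have sp : sigma <= p.
  by apply: le_trans ep; rewrite ler_pdivrMr// ler_peMr ?(ltW e0)// ler1n.
have p0 : 0 < p := lt_le_trans e0 ep.
have epsE : eps = n.+1%:R * sigma by rewrite mulrC divfK// gt_eqF.
have /andP[Phi0 Phi1] := slope_mass_bounds (ltW s0).
set Phi := slope_mass sigma in Phi0 Phi1 *.
rewrite (sum_farey _ (fun c k => strip_integral c k b sigma p q)).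
rewrite /farey_density /farey_err.
set K := \sum_(_ <= _ < _) coprime_ratio R _; set Q := \sum_(_ <= _ < _) (_ / _).
have -> : (q - p) * b * (Phi * n.+1%:R * (n.+1%:R^-1 * K)) = (q - p) * b * Phi * K.
  by field; rewrite gt_eqF.
have -> : (q - p) * eps * (n.+1%:R^-1 * Q) = (q - p) * sigma * Q.
  by rewrite /sigma; field; rewrite gt_eqF.
have -> : 2 * eps ^+ 2 = \sum_(1 <= c < n.+2) n.+1%:R * (2 * sigma ^+ 2).
  by rewrite sumr_const_nat subSS subn0 -mulr_natl epsE; ring.
rewrite /K /Q !mulr_sumr -sumrB -big_split/=.
apply: le_trans (ler_norm_sum _ _ _) _; apply: ler_sum_nat => c /andP[c0 cn].
have cR : 0 < c%:R :> R by rewrite ltr0n.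
have qp0 : 0 <= q - p by rewrite subr_ge0.
have row := @farey_row R c b ((q - p) / c%:R * Phi) ((q - p) * (sigma / c%:R))
  (2 * sigma ^+ 2) (fun k => strip_integral c k b sigma p q) c0 b01.
have -> : (q - p) * b * Phi * coprime_ratio R c =
    (q - p) / c%:R * Phi * c%:R * b * coprime_ratio R c.
  by field; rewrite gt_eqF.
apply: le_trans (row _ _ _ _ _) _.
- rewrite !mulr_ge0 ?invr_ge0 ?(ltW cR)//= -mulrA ler_wpM2l// mulrC.
  by rewrite ler_pM2r ?invr_gt0.
- by rewrite mulr_ge0// sqr_ge0.
- by move=> k kc _; apply: strip_integral_bounds => //; rewrite (ltW p0).
- by move=> k kc _ cbk; exact: strip_integral0.
- by move=> k kc kcop kcb; apply: strip_integral_full => //; rewrite s0.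
rewrite mulrA -mulrA [_^-1 * _]mulrC lerD2l ler_wpM2r//.
  by rewrite mulr_ge0// sqr_ge0.
by rewrite ler_nat -ltnS.
Qed.

(** The strips equidistribute relatively to [A] over the box as well: this is the
    equidistribution at each height, integrated over the heights. *)
Lemma cvg_strip_integral_discrepancy (b eps p q : R) :
  0 <= b -> 0 < eps <= p -> p <= q ->
  (\sum_(i <- farey n.+1) strip_integral i.1 i.2 b (eps / n.+1%:R) p q
    - eps * farey_density R n * itv_int (fun y => itv_measure (S y `&` `]0, b]%classic) 0 1) p q) @[n --> \oo] --> 0.
Proof.
move=> b0 /andP[e0 ep] pq; have p0 : 0 < p := lt_le_trans e0 ep.
pose D n y := strip_discrepancy eps y n (S y `&` `]0, b]%classic).
have bI : itv_bounded (fun y => itv_measure (S y `&` `]0, b]%classic) 0 1) p q.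
  rewrite (_ : (fun y => _) = (fun y => itv_measure (xsection (slopes A `&` (setT `*` `]0, b]%classic)) y) 0 1)).
    apply: itv_measure_xsection_bounded; apply: measurableI; first exact: measurable_slopes.
    exact: measurableX.
  apply/funext => y; apply: eq_itv_measure => t _; split.
    by move=> [/xsectionP Ht tb]; apply/xsectionP; split.
  by move=> /xsectionP[Ht [_ tb]]; split=> //; apply/xsectionP.
have bS n (i : nat * nat) : itv_bounded (fun y => if (0 < i.1)%N then y * itv_measure (S y `&` `]0, b]%classic)
    (i.2%:R / i.1%:R) (strip_end (eps / n.+1%:R) y i) else 0) p q.
  case: i => [[|c] k] /=.
    by split; [exact: measurable_cst|exists 0 => y _; rewrite normr0].
  by apply: strip_integrand_bounded => //; exact: ltW.
have sumE n y : strip_sum n.+1 (eps / n.+1%:R) y (S y `&` `]0, b]%classic) =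
   \sum_(i <- farey n.+1) (if (0 < i.1)%N then y * itv_measure (S y `&` `]0, b]%classic)
    (i.2%:R / i.1%:R) (strip_end (eps / n.+1%:R) y i) else 0).
  rewrite /strip_sum big_seq [RHS]big_seq; apply: eq_bigr => -[c k].
  by rewrite mem_farey => /andP[/andP[-> _] _].
have DE n : D n = (fun y => strip_sum n.+1 (eps / n.+1%:R) y (S y `&` `]0, b]%classic) -
    eps * farey_density R n * itv_measure (S y `&` `]0, b]%classic) 0 1) by [].
have bSum n : itv_bounded (fun y => strip_sum n.+1 (eps / n.+1%:R) y (S y `&` `]0, b]%classic)) p q.
  under eq_fun do rewrite sumE.
  exact: itv_bounded_sum.
have -> : (fun n => \sum_(i <- farey n.+1) strip_integral i.1 i.2 b (eps / n.+1%:R) p q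
    - eps * farey_density R n * itv_int (fun y => itv_measure (S y `&` `]0, b]%classic) 0 1) p q) =
   (fun n => itv_int (D n) p q).
  apply/funext => n; rewrite DE itv_intB//; last exact: itv_boundedZ.
  rewrite itv_intZ//; congr (_ - _).
  under [in RHS]eq_itv_int do rewrite sumE.
  rewrite itv_int_sum// big_seq [RHS]big_seq; apply: eq_bigr => -[c k].
  by rewrite mem_farey => /andP[/andP[c0 _] _]; rewrite c0.
have mSb y : measurable (S y `&` `]0, b]%classic : set (measurableTypeR R)).
  exact: measurableI.
apply: (@cvg_itv_int0 _ D p q q) => //.
- by move=> n; rewrite DE; apply: measurable_funB; [exact: (bSum n).1|exact: measurable_funM bI.1].
- move=> n y /andP[py yq].
  apply: le_trans (strip_discrepancy_bound e0 (le_trans ep (ltW py)) n (mSb y)) _.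
  have : itv_measure (S y `&` `]0, b]%classic) 0 1 <= 1 by rewrite -[leRHS]subr0 itv_measure_le.
  by move=> l1; rewrite -[leRHS]mulr1 ler_pM ?itv_measure_ge0// ltW// (lt_trans p0).
move=> y /andP[py yq]; apply: cvg_strip_discrepancy => //.
by rewrite (le_trans ep)// ltW.
Qed.

End strips.
End slope_coordinates.

(** * The density of an invariant set in boxes *)

Section boxes_unique.
Context (R : realType).
Local Notation R1 := (measurableTypeR R).
Variables m1 m2 : {measure set (R1 * R1) -> \bar R}.
Hypothesis m1oo : (m1 setT < +oo)%E.
Hypothesis m12 : forall a b c d : R,
  m1 (`]a, b]%classic `*` `]c, d]%classic) = m2 (`]a, b]%classic `*` `]c, d]%classic).

Let slice1 (m : {measure set (R1 * R1) -> \bar R}) (T : set R1) : measurable T ->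
  exists m' : {measure set R1 -> \bar R}, forall P, m' P = m (P `*` T).
Proof.
move=> mT; have mX : measurable (setT `*` T : set (R1 * R1)) by exact: measurableX.
have [m' m'E] := preimage_measure (mrestr m mX) (@measurable_fst _ _ R1 R1).
exists m' => P; rewrite m'E /= /mrestr; congr (m _).
by apply/seteqP; split=> -[x y] [] //= ? [].
Qed.

Let slice2 (m : {measure set (R1 * R1) -> \bar R}) (P : set R1) : measurable P ->
  exists m' : {measure set R1 -> \bar R}, forall T, m' T = m (P `*` T).
Proof.
move=> mP; have mX : measurable (P `*` setT : set (R1 * R1)) by exact: measurableX.
have [m' m'E] := preimage_measure (mrestr m mX) (@measurable_snd _ _ R1 R1).
exists m' => T; rewrite m'E /= /mrestr; congr (m _).
by apply/seteqP; split=> -[x y] [] //= ? [].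
Qed.

Let m1fin X : measurable X -> (m1 X < +oo)%E.
Proof. by move=> mX; apply: le_lt_trans m1oo; apply: le_measure; rewrite ?inE. Qed.

Lemma measure_boxes_unique X : measurable X -> m1 X = m2 X.
Proof.
have step1 c d (P : set R1) : measurable P ->
    m1 (P `*` `]c, d]%classic) = m2 (P `*` `]c, d]%classic).
  have [n1 n1E] := slice1 m1 (measurable_itv `]c, d] : measurable (_ : set R1)).
  have [n2 n2E] := slice1 m2 (measurable_itv `]c, d] : measurable (_ : set R1)).
  rewrite -n1E -n2E; apply: measure_ocitv_unique => a b; first by rewrite n1E n2E.
  by rewrite n1E m1fin//; exact: measurableX.
have step2 (P T : set R1) : measurable P -> measurable T -> m1 (P `*` T) = m2 (P `*` T).
  move=> mP; have [n1 n1E] := slice2 m1 mP; have [n2 n2E] := slice2 m2 mP.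
  rewrite -n1E -n2E; apply: measure_ocitv_unique => a b.
    by rewrite n1E n2E step1.
  by rewrite n1E m1fin//; exact: measurableX.
move=> mX; apply: (measure_unique [set P `*` T | P in measurable & T in measurable]
  (fun=> setT)) => //.
- by rewrite measurable_prod_measurableType.
- move=> _ _ [P mP [T mT <-]] [P' mP' [T' mT' <-]]; rewrite -setXI.
  by exists (P `&` P'); [exact: measurableI|exists (T `&` T') => //; exact: measurableI].
- by move=> _; exists setT => //; exists setT => //; rewrite setXTT.
- by rewrite bigcup_const.
- by move=> _ [P mP [T mT <-]]; exact: step2.
Qed.

End boxes_unique.

Section box_density.
Context (R : realType).
Local Notation mu := (@lebesgue_measure R).
Local Notation R2 := (measurableTypeR R * measurableTypeR R)%type.
Variable A : set R2.
Hypothesis mA : measurable A.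
Hypothesis invA : SL2Z_invariant A.
Local Notation S y := (xsection (slopes A) y).

(** The density of [A] in the strips, with the scale [sigma = eps / n.+1]. *)
Definition mass_ratio (eps : R) (n : nat) : R :=
  slope_mass A (eps / n.+1%:R) * n.+1%:R / eps.

Lemma itv_measure_setI_itv (T : set (measurableTypeR R)) (b : R) : 0 <= b <= 1 ->
  itv_measure (T `&` `]0, b]%classic) 0 1 = itv_measure T 0 b.
Proof.
move=> /andP[b0 b1]; congr (fine (mu _)); apply/seteqP; split=> t.
  by move=> [[Tt tb] _].
move=> [Tt tb]; split=> //; move: tb; rewrite /= !in_itv/= => /andP[-> tb].
exact: le_trans b1.
Qed.

(** Compares the two evaluations of the mass of [A] in the strips over a box: by
    equidistribution it is a multiple of the mass of [A] in the box, and by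
    periodicity it is a multiple of the measure of the box. The factors do not
    depend on the box. *)
Lemma near_slope_box (b eps p q : R) : 0 <= b <= 1 -> 0 < eps <= p -> p <= q ->
  \forall n \near \oo,
    `|slope_box A b p q - mass_ratio eps n * ((q - p) * b)| <= 13 * eps.
Proof.
move=> b01 ep pq; have /andP[b0 b1] := b01; have /andP[e0 ep'] := ep.
(* The error 3 * eps ^ 2 is divided by eps times the density of the strips,
   which is at least 1/4; the sieve accounts for one more eps. *)
have e20 : 0 < eps ^+ 2 by rewrite exprn_gt0.
have /cvgr0Pnorm_lt/(_ _ e20) := cvg_strip_integral_discrepancy mA b0 ep pq.
have qp1 : 0 < 4 * (q - p + 1) by rewrite mulr_gt0// ltr_wpDl ?subr_ge0.
have /cvgr0Pnorm_lt/(_ _ (divr_gt0 e0 qp1)) := @cvg_farey_err R.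
apply: filterS2 => n errn disn.
have := strip_integral_sum mA invA n b01 ep pq.
move: errn disn; rewrite /mass_ratio.
rewrite (_ : itv_int _ p q = slope_box A b p q); last first.
  by apply: eq_itv_int => y _; exact: itv_measure_setI_itv.
set X := \sum_(_ <- _) _; set m := slope_box _ _ _ _; set K := farey_density _ _.
set Phi := slope_mass _ _; set d := farey_err _ _; set N : R := n.+1%:R.
have /andP[K4 K1] := farey_density_bounds R n; rewrite -/K in K4.
rewrite ltr_pdivlMr// => errn disn sumn.
have d1 : 4 * ((q - p) * d) <= eps.
  have dn : d <= `|d| by exact: ler_norm.
  have : 0 <= q - p by rewrite subr_ge0.
  have := normr_ge0 d; nra.
have K0 : 0 < K by apply: lt_le_trans K4.
have eK : 0 < eps * K by rewrite mulr_gt0.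
rewrite -(ler_pM2l eK) -{1}(gtr0_norm eK) -normrM.
have -> : eps * K * (m - Phi * N / eps * ((q - p) * b)) =
    (X - (q - p) * b * (Phi * N * K)) - (X - eps * K * m).
  by field; rewrite gt_eqF.
apply: le_trans (ler_normB _ _) _; apply: le_trans (lerD sumn (ltW disn)) _.
have : eps * (4 * ((q - p) * d)) <= eps * eps by rewrite ler_pM2l.
have : eps * eps * 4^-1 <= eps * eps * K by rewrite ler_pM2l// mulr_gt0.
rewrite expr2; nra.
Qed.

(** Two boxes can be compared at the same scale, with an error proportional to an
    arbitrarily small [eps]. *)
Lemma slope_box_density (b p q : R) : 0 <= b <= 1 -> 0 < p <= q ->
  slope_box A b p q = slope_box A 1 1 2 * ((q - p) * b).
Proof.
move=> b01 /andP[p0 pq]; set k := slope_box A 1 1 2; set w := (q - p) * b.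
have w0 : 0 <= w by rewrite mulr_ge0 ?subr_ge0//; case/andP: b01.
apply/eqP; rewrite -subr_eq0 -normr_le0; apply/ler_addgt0Pr => e e0; rewrite add0r.
have C0 : 0 < 13 * (1 + w) by rewrite mulr_gt0// ltr_pwDl.
pose eps := Num.min (Num.min p 1) (e / (13 * (1 + w))).
have eps0 : 0 < eps by rewrite !lt_min p0 ltr01 divr_gt0.
have epsp : 0 < eps <= p by rewrite eps0/= !ge_min lexx.
have eps1 : 0 < eps <= 1 by rewrite eps0/= !ge_min lexx orbT.
have epse : eps * (13 * (1 + w)) <= e.
  by rewrite -ler_pdivlMr// ge_min lexx orbT.
have h1 := near_slope_box b01 epsp pq.
have h2 : \forall n \near \oo, `|k - mass_ratio eps n * ((2 - 1) * 1)| <= 13 * eps.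
  by apply: near_slope_box => //; rewrite ?ler01 ?lexx// ler1n.
have [n [{}h1 {}h2]] := filter_ex (filterI h1 h2).
move: h1 h2; rewrite -/w (_ : (2 - 1) * 1 = 1 :> R); last by ring.
rewrite mulr1; set m := slope_box A b p q; set a := mass_ratio eps n => h1 h2.
have -> : m - k * w = (m - a * w) - (k - a) * w by ring.
apply: le_trans (ler_normB _ _) _; rewrite normrM (ger0_norm w0).
have : `|k - a| * w <= 13 * eps * w by rewrite ler_wpM2r.
move: h1 epse; lra.
Qed.

Lemma measure_box (Z : set R2) (a b p q : R) : measurable Z ->
  (mu \x mu)%E (Z `&` (`]p, q]%classic `*` `]a, b]%classic)) =
  (itv_int (fun y => itv_measure (xsection Z y) a b) p q)%:E.
Proof.
move=> mZ; rewrite /itv_int /Rintegral fineK; last first.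
  apply: integrable_fin_num => //; apply: itv_bounded_integrable.
  exact: itv_measure_xsection_bounded.
rewrite /product_measure1 [RHS]integral_mkcond; apply: eq_integral => y _ /=.
rewrite patchE; case: ifPn => [/set_mem ypq|/negP ypq].
  rewrite -itv_measureE; last exact: measurable_xsection.
  congr (mu _); apply/seteqP; split=> t.
    by move=> /xsectionP[Zt [_ abt]]; split=> //; apply/xsectionP.
  by move=> [/xsectionP Zt abt]; apply/xsectionP.
rewrite (_ : xsection _ y = set0) ?measure0//.
by apply/seteqP; split=> // t /xsectionP[_ [ypq' _]]; apply: ypq; rewrite inE.
Qed.

Lemma itvoc_setI (a b c d : R) :
  `]a, b]%classic `&` `]c, d]%classic = `]Num.max a c, Num.min b d]%classic :> set R.
Proof.
apply/seteqP; split=> t /=; rewrite !in_itv/= gt_max le_min.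
  by move=> [/andP[-> ->] /andP[-> ->]].
by move=> /andP[/andP[-> ->] /andP[-> ->]].
Qed.

(** On a fixed box [D], having density [kappa] in all subboxes determines the
    restriction of the measure to [A]: it is [kappa] times the measure. The
    complement of [A] in [D] has measure [1 - kappa] and does not meet [A], so
    [kappa * (1 - kappa) = 0]. *)
Lemma slope_box_density01 : slope_box A 1 1 2 = 0 \/ slope_box A 1 1 2 = 1.
Proof.
set kappa := slope_box A 1 1 2.
have mE := measurable_slopes mA.
pose E := slopes A.
pose D : set R2 := `]1, 2]%classic `*` `]0, 1]%classic.
have mD : measurable D by exact: measurableX.
have mED : measurable (E `&` D) by exact: measurableI.
pose mu2 : {measure set R2 -> \bar R} := (mu \x mu)%E.
have k0 : 0 <= kappa by apply: itv_int_ge0 => y _; exact: itv_measure_ge0.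
have mu2D : mu2 D = 1%:E.
  rewrite /mu2/= product_measure1E//= !lebesgue_itvoc//; last by rewrite ler1n.
  by rewrite -EFinM; congr EFin; ring.
have mE' : measurable E by [].
have agree X : measurable X -> mu2 (X `&` (E `&` D)) = (kappa%:E * mu2 (X `&` D))%E.
  apply: (@measure_boxes_unique R (mrestr mu2 mED) (mscale (NngNum k0) (mrestr mu2 mD))).
    rewrite /= /mrestr setTI; apply: (@le_lt_trans _ _ (mu2 D)).
      by apply: le_measure; rewrite ?inE//; exact: subIsetr.
    by rewrite mu2D ltry.
  move=> a b c d; rewrite /= /mscale/= /mrestr.
  rewrite setICA -[in RHS]setXI -setXI !itvoc_setI.
  set a' := Num.max a 1; set b' := Num.min b 2; set c' := Num.max c 0; set d' := Num.min d 1.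
  have [a'b'|b'a'] := leP a' b'; last first.
    by rewrite (_ : `]a', b']%classic = set0) ?set0X ?setI0 ?measure0 ?mule0//
      set_itv_ge// -leNgt bnd_simp ltW.
  have [c'd'|d'c'] := leP c' d'; last first.
    by rewrite (_ : `]c', d']%classic = set0) ?setX0 ?setI0 ?measure0 ?mule0//
      set_itv_ge// -leNgt bnd_simp ltW.
  have a'1 : 1 <= a' by rewrite le_max lexx orbT.
  have c'0 : 0 <= c' by rewrite le_max lexx orbT.
  have d'1 : d' <= 1 by rewrite ge_min lexx orbT.
  rewrite /mu2/= measure_box// product_measure1E//= !lebesgue_itvoc// -!EFinM.
  congr EFin; rewrite (@eq_itv_int _ _ (fun y => itv_measure (S y) 0 d' - itv_measure (S y) 0 c')).
    rewrite itv_intB; try exact: itv_measure_xsection_bounded.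
    rewrite -![itv_int _ a' b']/(slope_box A _ a' b').
    have a'0 : 0 < a' <= b' by rewrite (lt_le_trans ltr01 a'1).
    rewrite !(@slope_box_density _ a' b') -/kappa//; last 2 first.
      by rewrite c'0 (le_trans c'd').
      by rewrite (le_trans c'0).
    by ring.
  move=> y _; rewrite (@itv_measure_cat _ _ 0 c' d')//; last exact: measurable_xsection.
  by rewrite addrAC subrr add0r.
have E1 := agree setT measurableT; have E2 := agree _ (measurableC mE').
move: E1 E2; rewrite !setTI mu2D mule1 [in X in _ -> X](setIA (~` E) E D) setICl set0I measure0 => E1 E2.
have E3 : mu2 (~` E `&` D) = (1 - kappa)%:E.
  have : mu2 D = (mu2 (E `&` D) + mu2 (~` E `&` D))%E.
    rewrite -measureU//; last 2 first.
    - by apply: measurableI => //; exact: measurableC.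
    - by apply/seteqP; split=> // z [[? _] []].
    by rewrite -setIUl setUv setTI.
  by rewrite mu2D E1 => /eqP; rewrite addeC -sube_eq ?fin_num_adde_defl// => /eqP <-; rewrite EFinB.
move: E2; rewrite E3 -EFinM => -[] /esym/eqP; rewrite mulf_eq0 subr_eq0.
by move=> /orP[/eqP|/eqP]; [left|right].
Qed.

End box_density.

(** * Ergodicity of SL(2, Z) on the plane *)

Section product_null.
Local Open Scope ereal_scope.
Context d1 d2 (T1 : measurableType d1) (T2 : measurableType d2) (R : realType).
Variables (m1 : {sigma_finite_measure set T1 -> \bar R})
          (m2 : {sigma_finite_measure set T2 -> \bar R}).

Lemma product_null_ysection (A : set (T1 * T2)) : measurable A ->
  (m1 \x m2) A = 0 <-> {ae m2, forall y, m1 (ysection A y) = 0}.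
Proof.
move=> mA; have := @ae_eq_integral_abs _ T2 R m2 setT measurableT (m1 \o ysection A)
  (measurable_fun_ysection m1 mA).
rewrite (@product_measure_unique _ _ _ _ _ m1 m2 (m1 \x^ m2)%E)//; last first.
  by move=> B C mB mC /=; rewrite product_measure2E.
rewrite (_ : \int[m2]_x `|_| = (m1 \x^ m2) A); last first.
  by apply: eq_integral => x _; rewrite gee0_abs.
move=> ->; split; apply: filterS => x; first by apply.
by move=> + _.
Qed.

End product_null.

Section plane.
Context (R : realType).
Local Notation mu := (@lebesgue_measure R).
Local Notation R1 := (measurableTypeR R).
Local Notation R2 := (R1 * R1)%type.

Lemma periodic_null (T : set R1) : measurable T ->
  (forall t, T (t + 1) <-> T t) -> itv_measure T 0 1 = 0 -> mu T = 0%E.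
Proof.
move=> mT perT T0; apply/measure_negligible => //.
have -> : T = \bigcup_n (T `&` `](- n%:R), n%:R]%classic).
  rewrite -setI_bigcupr; apply/esym/setIidPl => x _.
  exists (Num.truncn `|x|).+1 => //=.
  by rewrite in_itv/=; have := truncnS_gt `|x|; rewrite ltr_norml => /andP[-> /ltW//].
apply: negligible_bigcup => n; apply/negligibleP; first exact: measurable_setI_itvoc.
rewrite /= itv_measureE//; have := @itv_measure_windows R T 1 (- n%:Z) (n + n) mT ler01 perT.
rewrite T0 !mulr1 mulr0 intrN natrD addrA addNr add0r => h.
by congr EFin.
Qed.

Lemma itv_int_eq0 (f : R -> R) (p q : R) : itv_bounded f p q ->
  (forall y, 0 <= f y) -> itv_int f p q = 0 ->
  mu.-negligible [set y | p < y <= q /\ f y <> 0].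
Proof.
move=> fb f0 if0; have fi := itv_bounded_integrable fb.
have mf : measurable_fun `]p, q]%classic (EFin \o f).
  by apply/measurable_EFinP; exact: fb.1.
have [+ _] := @ae_eq_integral_abs _ R1 R mu `]p, q]%classic (measurable_itv _) _ mf.
have E : (\int[mu]_(x in `]p, q]%classic) `|(EFin \o f) x| =
    \int[mu]_(x in `]p, q]%classic) (EFin \o f) x)%E.
  by apply: eq_integral => x _; rewrite gee0_abs// lee_fin.
rewrite E -[X in (X = _ -> _)]fineK; last exact: integrable_fin_num.
rewrite -[fine _]/(itv_int f p q) if0.
move=> /(_ erefl); apply: negligibleS => y /= [ypq fy] H; apply: fy.
have : (f y)%:E = 0%:E :> \bar R by apply: H; rewrite in_itv.
by case.
Qed.

(** At almost every height [y > 0] the periodic section of slopes is null, hence so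
    is the section of [A], which is [y] times it; the lower half plane follows by
    [- 1%:M]. *)
Lemma slope_density0_null (A : set R2) : measurable A -> SL2Z_invariant A ->
  slope_box A 1 1 2 = 0 -> (mu \x mu)%E A = 0%E.
Proof.
move=> mA invA k0; apply/product_null_ysection => //.
pose S y := xsection (slopes A) y.
have mS y : measurable (S y : set R1).
  by apply: measurable_xsection; exact: measurable_slopes.
pose Bad : set R1 := [set y | itv_measure (S y) 0 1 <> 0].
have nullpos : mu.-negligible (Bad `&` [set y | 0 < y]).
  have -> : Bad `&` [set y | 0 < y] =
     \bigcup_n [set y | n.+1%:R^-1 < y <= n.+1%:R /\ itv_measure (S y) 0 1 <> 0].
    apply/seteqP; split=> y; last first.
      by move=> [n _ [/andP[ny _] By]]; split=> //=; apply: lt_trans ny.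
    move=> [By /= y0]; pose n := (Num.truncn y + Num.truncn y^-1)%N.
    exists n => //; split=> //; apply/andP; split.
      rewrite invf_plt ?posrE//; apply: lt_le_trans (truncnS_gt _) _.
      by rewrite ler_nat ltnS leq_addl.
    by apply: le_trans (ltW (truncnS_gt _)) _; rewrite ler_nat ltnS leq_addr.
  apply: negligible_bigcup => n; apply: itv_int_eq0.
  - by apply: itv_measure_xsection_bounded; exact: measurable_slopes.
  - by move=> y; exact: itv_measure_ge0.
  rewrite -[LHS]/(slope_box A 1 _ _) slope_box_density ?k0 ?mul0r ?ler01 ?lexx//.
  by rewrite invr_gt0 ltr0n/= (@le_trans _ _ 1)// ?invf_le1 ?ler1n.
have sec y : 0 < y -> ~ Bad y -> mu (ysection A y) = 0%E.
  move=> y0 /contrapT By.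
  have S0 : mu (S y) = 0%E.
    by apply: periodic_null => //; move=> t; exact: slope_periodic.
  have -> : ysection A y = (fun x : R => y^-1 * x + 0) @^-1` S y.
    apply/seteqP; split=> x.
      move=> /ysectionP Axy; apply/in_slope.
      by rewrite addr0 mulrC mulrA divff ?gt_eqF// mul1r.
    move=> /in_slope; rewrite addr0 mulrC mulrA divff ?gt_eqF// mul1r => Axy.
    exact/ysectionP.
  by rewrite lebesgue_affine ?gt_eqF ?invr_gt0// S0 mule0.
have secN y : mu (ysection A (- y)) = mu (ysection A y).
  rewrite -lebesgue_measureN; last exact: measurable_ysection.
  rewrite /pushforward; congr (mu _); apply/seteqP.
  have H x : A (- x, - y) <-> A (x, y).
    have := @invA (-1) 0 0 (-1) erefl x y.
    by rewrite !mul0r addr0 add0r !mulN1r.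
  by split=> x /ysectionP h; apply/ysectionP/H.
have neg0 : mu.-negligible [set 0%R : R1].
  by apply/negligibleP => //; exact: lebesgue_measure_set1.
have nullneg : mu.-negligible (-%R @^-1` (Bad `&` [set y | 0 < y]) : set R1).
  have [N [mN N0 sub]] := nullpos.
  exists (-%R @^-1` N); split.
  - by rewrite -[X in measurable X]setTI; apply: (_ : measurable_fun setT (-%R : R1 -> R1)).
  - by have := lebesgue_measureN mN; rewrite /pushforward N0.
  - by move=> y; exact: sub.
apply: negligibleS (negligibleU neg0 (negligibleU nullpos nullneg)) => y /= ny.
have [y0|y0|->] := ltgtP y 0; last by left.
- right; right; split; last by rewrite /= oppr_gt0.
  by apply: contrapT => nB; apply: ny; rewrite -secN sec// oppr_gt0.
- right; left; split=> //; apply: contrapT => nB; apply: ny; exact: sec.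
Qed.

Lemma SL2Z_invariantC (A : set R2) : SL2Z_invariant A -> SL2Z_invariant (~` A).
Proof. by move=> invA a b c d abcd x y; split; apply: contra_not; rewrite invA. Qed.

(** The ergodicity of SL(2, Z) on the plane: density 1 is density 0 for the
    complement. *)
Lemma SL2Z_zero_one (A : set R2) : measurable A -> SL2Z_invariant A ->
  (mu \x mu)%E A = 0%E \/ (mu \x mu)%E (~` A) = 0%E.
Proof.
move=> mA invA; have mAC := measurableC mA; have invAC := SL2Z_invariantC invA.
have [k0|k1] := slope_box_density01 mA invA; [left|right].
  exact: slope_density0_null.
apply: slope_density0_null => //.
rewrite /slope_box (@eq_itv_int _ _ (fun y => 1 - itv_measure (xsection (slopes A) y) 0 1)).
  rewrite itv_intB.
  - rewrite -[X in _ - X]/(slope_box A 1 1 2) k1 /itv_int Rintegral_cst//=.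
    by rewrite lebesgue_itvoc ?ler1n//= mul1r; ring.
  - by split; [exact: measurable_cst|exists `|1| => y _].
  - by apply: itv_measure_xsection_bounded; exact: measurable_slopes.
move=> y _; rewrite -[X in X - _](subr0 1) -itv_measure_setC//; last first.
  by apply: measurable_xsection; exact: measurable_slopes.
by apply: eq_itv_measure => t _; split=> [/xsectionP h /xsectionP//|h]; apply/xsectionP => /xsectionP.
Qed.

End plane.

(** * Sets invariant under small translations *)

Section dense_subgroup.
Context (R : realType).
Local Notation mu := (@lebesgue_measure R).

(** If the subgroup [H] generated by [x] and [y] had a least positive element, then
    [x] and [y] would be integer multiples of it, and their ratio rational. *)
Lemma small_int_combination (x y e : R) : 0 < e -> y != 0 ->
  (forall q : rat, x != ratr q * y) ->
  exists a b : int, 0 < a%:~R * x + b%:~R * y < e.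
Proof.
move=> e0 y0 irr.
pose H : set R := [set z | exists a b : int, z = a%:~R * x + b%:~R * y].
have HB z z' : H z -> H z' -> H (z - z').
  move=> [a [b ->]] [a' [b' ->]]; exists (a - a'), (b - b').
  by rewrite !intrB; ring.
have HM (k : int) z : H z -> H (k%:~R * z).
  by move=> [a [b ->]]; exists (k * a), (k * b); rewrite !intrM; ring.
have Hx : H x by exists 1, 0; rewrite mul1r mul0r addr0.
have Hy : H y by exists 0, 1; rewrite mul1r mul0r add0r.
pose P : set R := [set z | H z /\ 0 < z].
have P0 : P !=set0.
  have [y1|y1|/eqP] := ltgtP 0 y; last by rewrite eq_sym (negPf y0).
    by exists y.
  by exists (- y); split; rewrite ?oppr_gt0//; have := HM (-1) y Hy; rewrite mulN1r.
have lbP : has_lbound P by exists 0 => z [_ /ltW].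
have infP : has_inf P by [].
have g0 : 0 <= inf P by apply: lb_le_inf => // z [_ /ltW].
have [ginf|gpos] : inf P = 0 \/ 0 < inf P.
  by move: g0; rewrite le_eqVlt => /predU1P[<-|]; [left|right].
  have [z [[a [b zE]] z0] ze] := inf_adherent e0 infP.
  by exists a, b; rewrite -zE z0/= -[e]add0r -ginf.
exfalso; set g := inf P in gpos.
have Pg z : P z -> g <= z by move=> Pz; exact: ge_inf.
have Hg : H g.
  have [z Pz zg] := inf_adherent gpos infP.
  have [-> |zne] := eqVneq g z; first by case: Pz.
  have gz : g < z by rewrite lt_neqAle zne Pg.
  have zg0 : 0 < z - g by rewrite subr_gt0.
  have [z' Pz' z'z] := inf_adherent zg0 infP.
  have : g <= z - z'.
    apply: Pg; split; first by apply: HB; [case: Pz|case: Pz'].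
    by move: z'z; rewrite -/g addrC subrK subr_gt0.
  by have := Pg _ Pz'; move: zg; rewrite -/g; lra.
have mult z : H z -> exists k : int, z = k%:~R * g.
  move=> Hz; exists (Num.floor (z / g)); set k := Num.floor _.
  have /andP[k1 k2] := floor_itv (z / g).
  apply/eqP; rewrite -subr_eq0 eq_le; apply/andP; split; last first.
    by rewrite subr_ge0 -ler_pdivlMr.
  rewrite leNgt; apply/negP => r0.
  have : g <= z - k%:~R * g by apply: Pg; split=> //; apply: HB => //; exact: HM.
  by move: k2; rewrite intrD ltr_pdivrMr// mulrDl mul1r -/k; lra.
have [k xE] := mult x Hx; have [l yE] := mult y Hy.
have l0 : l != 0 by apply: contra y0 => /eqP l0; rewrite yE l0 mul0r.
have := irr (k%:~R / l%:~R).
rewrite fmorph_div/= !ratr_int xE yE mulrA divfK ?eqxx//.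
by rewrite intr_eq0.
Qed.

(** By [itv_measure_periodic], the measure of [T] in an interval depends only on the length
    of this interval, up to the size of the periods. *)
Lemma small_periods_zero_one (T : set (measurableTypeR R)) : measurable T ->
  (forall e, 0 < e -> exists2 tau, 0 < tau < e & forall t, T (t + tau) <-> T t) ->
  mu T = 0%E \/ mu (~` T) = 0%E.
Proof.
move=> mT per; apply: (@lebesgue_zero_one _ _ (itv_measure T 0 1)) => // a b ab.
have ba0 : 0 <= b - a by rewrite subr_ge0.
apply/eqP; rewrite -subr_eq0 -normr_le0; apply/ler_addgt0Pr => e e0; rewrite add0r.
have C0 : 0 < 2 * (1 + (b - a)) by rewrite mulr_gt0// ltr_pwDl.
have [tau /andP[tau0 taue] perT] := per _ (divr_gt0 e0 C0).
have h1 := itv_measure_periodic mT tau0 ab perT.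
have h2 := itv_measure_periodic mT tau0 ler01 perT.
move: taue h1 h2; rewrite ltr_pdivlMr// subr0 mul1r.
set r := itv_measure T 0 tau / tau; set k := itv_measure T 0 1 => taue h1 h2.
have -> : itv_measure T a b - k * (b - a) = (itv_measure T a b - (b - a) * r) - (k - r) * (b - a) by ring.
apply: le_trans (ler_normB _ _) _; rewrite normrM (ger0_norm ba0).
have : `|k - r| * (b - a) <= 2 * tau * (b - a) by rewrite ler_wpM2r.
by move: h1 taue; lra.
Qed.

End dense_subgroup.

(** * The groups, and the dual action *)

Section integer_matrix_groups.
Context (R : realType).

Definition SLZ (n : nat) : set 'M[R]_n :=
  [set g | exists2 M : 'M[int]_n, \det M = 1 & g = map_mx intr M].

Definition e0_cV (n : nat) : 'cV[R]_n.+1 := cV_cons (1, 0).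

(** In block form, the matrices [(1, w; 0, h)] with [w] an integer row and [h] in
    SL(n, Z). *)
Definition affine_SLZ (n : nat) : set 'M[R]_n.+1 :=
  [set g | SLZ g /\ g *m e0_cV n = e0_cV n].

Lemma det_SLZ (n : nat) (g : 'M[R]_n) : SLZ g -> \det g = 1.
Proof. by move=> [M M1 ->]; rewrite det_map_mx M1. Qed.

Lemma unitmx_SLZ (n : nat) (g : 'M[R]_n) : SLZ g -> g \in unitmx.
Proof. by move=> /det_SLZ g1; rewrite unitmxE g1 unitr1. Qed.

Lemma SLZ1 (n : nat) : SLZ (1%:M : 'M[R]_n).
Proof. by exists 1%:M; rewrite ?det1// map_mx1. Qed.

Lemma SLZM (n : nat) (g h : 'M[R]_n) : SLZ g -> SLZ h -> SLZ (g *m h).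
Proof.
move=> [M M1 ->] [N N1 ->]; exists (M *m N); first by rewrite det_mulmx M1 N1 mulr1.
by rewrite map_mxM.
Qed.

Lemma SLZV (n : nat) (g : 'M[R]_n) : SLZ g -> SLZ (invmx g).
Proof.
move=> Sg; have gu := unitmx_SLZ Sg; case: (Sg) => M M1 gM.
have MI : M *m \adj M = 1%:M by rewrite mul_mx_adj M1.
exists (\adj M).
  by have := congr1 determinant MI; rewrite det_mulmx M1 mul1r det1.
by rewrite -[RHS]mul1mx -(mulVmx gu) -mulmxA {3}gM -map_mxM MI map_mx1 mulmx1.
Qed.

Lemma affine_SLZ_subgroup (n : nat) : is_subgroup_SL (@affine_SLZ n).
Proof.
split.
- by move=> g [/det_SLZ g1 _]; exact: g1.
- by split; [exact: SLZ1|rewrite mul1mx].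
- by move=> g h [Sg ge] [Sh he]; split; [exact: SLZM|rewrite -mulmxA he].
- by move=> g [Sg ge]; split; [exact: SLZV|rewrite -{1}ge mulKmx// unitmx_SLZ].
Qed.

Lemma countable_affine_SLZ (n : nat) : countable (@affine_SLZ n).
Proof.
apply: (@sub_countable _ _ _ (range (map_mx intr : 'M[int]_n.+1 -> 'M[R]_n.+1))).
  by apply: subset_card_le => g [[M _ ->] _]; exists M.
by apply: sub_countable (card_image_le _ _) _.
Qed.

(** Distinct integer matrices are at distance at least 1. *)
Lemma discrete_affine_SLZ (n : nat) : discrete_subset (@affine_SLZ n).
Proof.
move=> g Gg; case: (Gg) => -[M M1 gM] _.
split; first exact: mem_set.
exists (ball g 1); first exact: nbhsx_ballx.
apply/seteqP; split=> [h [gh [[N _ hN] _]]|_ ->]; last by split=> //; exact: ballxx.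
apply/matrixP => i j; have [_ /(_ i j)] := gh.
rewrite /ball/= gM hN !mxE -intrB -intr_norm ltrz1 -abszE ltz_nat ltnS leqn0.
by rewrite absz_eq0 subr_eq0 => /eqP ->.
Qed.

(** As [g] fixes the first basis vector, the inverse transpose of [g] preserves the
    first coordinate: the half space where it is positive is invariant. *)
Lemma dual_affine_SLZ_not_ergodic (n : nat) : ~ ergodic (dual_group (@affine_SLZ n)).
Proof.
have e0E (v : 'cV[R]_n.+1) : (v^T *m e0_cV n) ord0 ord0 = v ord0 ord0.
  rewrite mxE big_ord_recl big1 ?addr0; last first.
    by move=> i _; rewrite /e0_cV (@cV_consP R n (1, 0)).2/= !mxE mulr0.
  by rewrite /e0_cV (@cV_consP R n (1, 0)).1/= mulr1 mxE.
pose A : set (borel_cV R n.+1) := @cV_uncons R n @^-1` (`]0, +oo[%classic `*` setT).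
have mA : measurable A.
  rewrite -[X in measurable X]setTI; apply: measurable_cV_uncons => //.
  exact: measurableX.
have inA (v : 'cV[R]_n.+1) : A v <-> 0 < v ord0 ord0.
  rewrite /A /cV_uncons /preimage/=; split=> [[/=]|v0]; first by rewrite in_itv/= andbT.
  by split=> //=; rewrite in_itv/= andbT.
have dual0 g (v : 'cV[R]_n.+1) : affine_SLZ g ->
    (invmx g^T *m v) ord0 ord0 = v ord0 ord0.
  move=> [Sg ge]; rewrite -!e0E trmx_mul -mulmxA; congr ((_ *m _) _ _).
  by rewrite -trmx_inv trmxK -{1}ge mulKmx// unitmx_SLZ.
have box (a b : R) : a <= b -> lebesgue_cV R n.+1 (cV_box (const_mx a) (const_mx b)) =
    ((b - a) ^+ n.+1)%:E.
  move=> ab; rewrite lebesgue_cV_box; last by move=> i; rewrite !mxE.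
  under eq_bigr do rewrite !mxE.
  by rewrite prodr_const card_ord.
have not_null (B : set (borel_cV R n.+1)) (a b : R) : measurable B -> a < b ->
    cV_box (const_mx a) (const_mx b) `<=` B -> lebesgue_cV R n.+1 B <> 0%E.
  move=> mB ab sub B0; have := box a b (ltW ab).
  have : (lebesgue_cV R n.+1 (cV_box (const_mx a) (const_mx b)) <= 0)%E.
    by rewrite -B0; apply: le_measure; rewrite ?inE//; exact: measurable_cV_box.
  move=> + E; rewrite E lee_fin leNgt => /negP; apply.
  by rewrite exprn_gt0// subr_gt0.
move=> /(_ A mA) [].
- move=> _ [g Gg <-]; apply/seteqP; split=> [_ [v Av <-]|v Av].
    by apply/inA; rewrite dual0//; exact/inA.
  have gu : g^T \in unitmx by rewrite unitmx_tr unitmx_SLZ//; case: Gg.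
  exists (g^T *m v); last by rewrite mulKmx.
  by apply/inA; rewrite -(dual0 g)// mulKmx//; exact/inA.
- apply: (not_null A 1 2) => //; first by rewrite ltr1n.
  move=> v /(_ ord0); rewrite !mxE => /andP[v1 _]; apply/inA.
  exact: lt_le_trans v1.
apply: (not_null (~` A) (-1) 0 (measurableC mA)); first by rewrite ltrN10.
move=> v /(_ ord0); rewrite !mxE => /andP[_ v0] /inA.
by rewrite ltNge v0.
Qed.

End integer_matrix_groups.

(** * Ergodicity in higher dimension *)

Section ergodicity.
Context (R : realType).
Local Notation mu := (@lebesgue_measure R).
Local Notation R1 := (measurableTypeR R).

Lemma lebesgue_cV_null_slices (n : nat) (A : set (borel_cV R n.+1)) : measurable A ->
  lebesgue_cV R n.+1 A = 0%E <->
  {ae lebesgue_cV R n, forall v, mu [set t : R1 | A (cV_cons (t, v))] = 0%E}.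
Proof.
move=> mA; have mcA : measurable (@cV_cons R n @^-1` A).
  by rewrite -[X in measurable X]setTI; exact: measurable_cV_cons.
have -> : lebesgue_cV R n.+1 A = (mu \x lebesgue_cV R n)%E (@cV_cons R n @^-1` A) by [].
rewrite product_null_ysection//.
by split; apply: filterS => v; rewrite ysectionE.
Qed.

Lemma lebesgue_cVX (n : nat) (T : set R1) (B : set (borel_cV R n)) :
  measurable T -> measurable B ->
  lebesgue_cV R n.+1 (@cV_uncons R n @^-1` (T `*` B)) =
  (mu T * lebesgue_cV R n B)%E.
Proof. exact: lebesgue_consX. Qed.

Lemma invariant_mem (n : nat) (G : set 'M[R]_n) (A : set 'cV[R]_n) :
  (forall g, G g -> [set g *m x | x in A] = A) ->
  forall g x, G g -> g \in unitmx -> A (g *m x) <-> A x.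
Proof.
move=> invA g x Gg gu; split=> [|Ax]; last by rewrite -(invA g Gg); exists x.
by rewrite -{1}(invA g Gg) => -[y Ay /(can_inj (mulKmx gu)) <-].
Qed.

Lemma ergodic_sub (n : nat) (G H : set 'M[R]_n) : G `<=` H -> ergodic G -> ergodic H.
Proof. by move=> GH eG A mA invA; apply: eG => // g /GH; exact: invA. Qed.

Lemma cV2P (v w : 'cV[R]_2) : v ord0 ord0 = w ord0 ord0 ->
  v (lift ord0 ord0) ord0 = w (lift ord0 ord0) ord0 -> v = w.
Proof.
move=> v0 v1; apply/matrixP => i j; rewrite ord1.
by case: (unliftP ord0 i) => [k ->|-> //]; rewrite ord1.
Qed.

Lemma SL2Z_ergodic : ergodic (@SLZ R 2).
Proof.
move=> A mA invA.
pose vec (p : R1 * R1) : borel_cV R 2 := cV_cons (p.1, cV_cons (p.2, 0)).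
have mvec1 : measurable_fun setT (fun y : R1 => cV_cons (y, 0) : borel_cV R 1).
  apply: (measurableT_comp (@measurable_cV_cons R 0) (g := fun y : R1 => (y, 0 : borel_cV R 0))).
  exact: measurable_fun_pair.
have mvec : measurable_fun setT vec.
  apply: (measurableT_comp (@measurable_cV_cons R 1)
    (g := fun p : R1 * R1 => (p.1, cV_cons (p.2, 0) : borel_cV R 1))).
  apply: measurable_fun_pair => //.
  exact: (measurableT_comp mvec1 (@measurable_snd _ _ R1 R1)).
have mpre (B : set (borel_cV R 2)) : measurable B -> measurable (vec @^-1` B).
  by move=> mB; rewrite -[X in measurable X]setTI; exact: mvec.
have null (B : set (borel_cV R 2)) : measurable B ->
    (mu \x mu)%E (vec @^-1` B) = 0%E -> lebesgue_cV R 2 B = 0%E.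
  move=> mB /product_null_ysection => /(_ (mpre _ mB)) [N [mN N0 sub]].
  apply/lebesgue_cV_null_slices => //.
  pose N' : set (borel_cV R 1) := @cV_uncons R 0 @^-1` (N `*` setT).
  exists N'; split.
  - rewrite -[X in measurable X]setTI; apply: measurable_cV_uncons => //.
    exact: measurableX.
  - by rewrite lebesgue_cVX// N0 mul0e.
  move=> v /= nv; split=> //; apply: sub => /=; move: nv; rewrite ysectionE.
  suff -> : v = cV_cons ((v : 'cV[R]_1) ord0 ord0, 0) by rewrite (cV_consP _).1.
  apply/matrixP => i j; rewrite !ord1.
  by have [-> _] := cV_consP ((v : 'cV[R]_1) ord0 ord0, 0 : 'cV[R]_0).
have invA2 : SL2Z_invariant (vec @^-1` A).
  move=> a b c d abcd x y.
  pose M : 'M[int]_2 := \matrix_(i, j) nth 0 (nth [::] [:: [:: a; b]; [:: c; d]] i) j.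
  have M1 : \det M = 1.
    rewrite (expand_det_row _ ord0) !big_ord_recl big_ord0 /cofactor !det_mx11 !mxE/=.
    by rewrite addr0 expr0 mul1r expr1 mulN1r mulrN.
  have SM : SLZ (map_mx intr M : 'M[R]_2) by exists M.
  rewrite /preimage/= -(invariant_mem invA (vec (x, y)) SM (unitmx_SLZ SM)).
  suff -> : map_mx intr M *m (vec (x, y) : 'cV[R]_2) =
    vec (a%:~R * x + b%:~R * y, c%:~R * x + d%:~R * y) by [].
  have vecP (p : R1 * R1) : (vec p : 'cV[R]_2) ord0 ord0 = p.1 /\
      (vec p : 'cV[R]_2) (lift ord0 ord0) ord0 = p.2.
    rewrite /vec; have [-> ->] := cV_consP (p.1, cV_cons (p.2, 0) : 'cV[R]_1).
    by have [-> _] := cV_consP (p.2, 0 : 'cV[R]_0).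
  by apply: cV2P; rewrite [LHS]mxE !big_ord_recl big_ord0 addr0
    !(vecP _).1 !(vecP _).2 !mxE.
have [A0|A1] := SL2Z_zero_one (mpre _ mA) invA2; [left|right]; apply: null => //.
exact: measurableC.
Qed.

Section step.
Variable n : nat.

Lemma block_mx_cV_cons (w : 'rV[R]_n) (h : 'M[R]_n) (t : R) (v : 'cV[R]_n) :
  (block_mx 1%:M w 0 h : 'M[R]_n.+1) *m (cV_cons (t, v) : 'cV[R]_n.+1) =
  cV_cons (t + (w *m v) ord0 ord0, h *m v).
Proof.
apply: etrans (mul_block_col 1%:M w 0 h (t%:M : 'M[R]_1) v) _.
rewrite mul1mx mul0mx add0r; congr col_mx.
by apply/matrixP => i j; rewrite !ord1 mxE [RHS]mxE mxE/= !mulr1n.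
Qed.

Definition affine_mx (w : 'rV[int]_n) (h : 'M[int]_n) : 'M[R]_n.+1 :=
  block_mx 1%:M (map_mx intr w) 0 (map_mx intr h).

Lemma affine_mx_SLZ (w : 'rV[int]_n) (h : 'M[int]_n) : \det h = 1 ->
  affine_SLZ (affine_mx w h).
Proof.
move=> h1; split; last first.
  by rewrite /affine_mx /e0_cV block_mx_cV_cons !mulmx0 mxE addr0.
exists (block_mx 1%:M w 0 h : 'M[int]_(1 + n)).
  by apply: etrans (@det_ublock _ 1 n 1%:M w h) _; rewrite det1 mul1r.
by rewrite /affine_mx (map_block_mx _ 1%:M w 0 h) map_mx1 map_mx0.
Qed.

End step.

(** For given last coordinates, the second one being nonzero, the excluded values of
    the first coordinate form a countable set. *)
Lemma irrational_slope_ae (n : nat) :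
  {ae lebesgue_cV R n.+2, forall v : 'cV[R]_n.+2, v (lift ord0 ord0) ord0 != 0 /\
     forall q : rat, v ord0 ord0 != ratr q * v (lift ord0 ord0) ord0}.
Proof.
have unconsE (m : nat) (v : borel_cV R m.+1) :
    (cV_uncons v).1 = (v : 'cV[R]_m.+1) ord0 ord0 by [].
pose x0 (v : borel_cV R n.+2) : R1 := (cV_uncons v).1.
pose x1 (v : borel_cV R n.+2) : R1 := (cV_uncons (cV_uncons v).2).1.
have x1E v : x1 v = (v : 'cV[R]_n.+2) (lift ord0 ord0) ord0 by rewrite /x1 unconsE mxE.
have [mx0 mtl] := (measurable_fun_pairP _).1 (@measurable_cV_uncons R n.+1).
have [mhd _] := (measurable_fun_pairP _).1 (@measurable_cV_uncons R n).
have mx1 : measurable_fun setT x1 := measurableT_comp mhd mtl.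
pose W1 : set (borel_cV R n.+2) := [set v | x1 v = 0].
have W10 : lebesgue_cV R n.+2 W1 = 0%E.
  have -> : W1 = @cV_uncons R n.+1 @^-1` (setT `*` (@cV_uncons R n @^-1` ([set 0] `*` setT))).
    by apply/seteqP; split=> v; [move=> v0|move=> [_ [v0 _]]].
  have m0 : measurable (@cV_uncons R n @^-1` ([set 0] `*` setT)).
    rewrite -[X in measurable X]setTI; apply: measurable_cV_uncons => //.
    exact: measurableX.
  by rewrite lebesgue_cVX// lebesgue_cVX//= (@lebesgue_measure_set1 R 0) mul0e mule0.
pose W2 : set (borel_cV R n.+2) := \bigcup_(q : rat) [set v | x0 v - ratr q * x1 v = 0].
have mW2 : measurable W2.
  apply: countable_bigcupT_measurable => // q.
  rewrite -[X in measurable X]setTI.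
  have mf : measurable_fun setT (fun v => x0 v - ratr q * x1 v : R1).
    by apply: measurable_funB => //; exact: measurable_funM.
  exact: (mf measurableT _ (measurable_set1 0)).
have W20 : lebesgue_cV R n.+2 W2 = 0%E.
  apply/lebesgue_cV_null_slices => //; apply: aeW => v.
  apply: countable_lebesgue_measure0.
  apply: (@sub_countable _ _ _ (range (fun q : rat => ratr q * (v : 'cV[R]_n.+1) ord0 ord0 : R))).
    apply: subset_card_le => t [q _ /= /eqP]; rewrite subr_eq0 => /eqP tq.
    exists q => //; move: tq; rewrite /x0 /x1 cV_consK/=; exact: esym.
  exact: sub_countable (card_image_le _ _) _.
have mW1 : measurable W1.
  by rewrite -[X in measurable X]setTI; exact: (mx1 measurableT _ (measurable_set1 0)).
have W12 := negligibleU ((negligibleP _ mW1).2 W10) ((negligibleP _ mW2).2 W20).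
apply: negligibleS W12 => v /= nv; apply: contrapT => nW; apply: nv.
rewrite -x1E; split.
  by apply/eqP => v1; apply: nW; left.
move=> q; apply/eqP => vq; apply: nW; right; exists q => //=.
by rewrite /x0 unconsE vq subrr.
Qed.

(** The translations [t |-> t + w v] act on the slice over [v] of an invariant set.
    For almost every [v] they are arbitrarily small, so this slice is null or
    conull. Which of the two occurs is an SL(n, Z)-invariant property of [v], so
    it is the same almost everywhere. *)
Lemma affine_SLZ_ergodic (n : nat) : ergodic (@SLZ R n.+2) -> ergodic (@affine_SLZ R n.+2).
Proof.
move=> ergS A mA invA.
have inv g x : affine_SLZ g -> A (g *m x) <-> A x.
  by move=> Gg; apply: (invariant_mem invA) => //; apply: unitmx_SLZ; case: Gg.
pose sl (v : borel_cV R n.+2) : set R1 := [set t : R1 | A (cV_cons (t, v))].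
have mcA : measurable (@cV_cons R n.+2 @^-1` A).
  by rewrite -[X in measurable X]setTI; exact: measurable_cV_cons.
have slE v : sl v = ysection (@cV_cons R n.+2 @^-1` A) v by rewrite ysectionE.
have msl v : measurable (sl v) by rewrite slE; exact: measurable_ysection.
have aeF : Filter (almost_everywhere (lebesgue_cV R n.+2)).
  exact: ae_filter_ringOfSetsType.
have sl01 : {ae lebesgue_cV R n.+2, forall v, mu (sl v) = 0%E \/ mu (~` sl v) = 0%E}.
  apply: filterS (irrational_slope_ae n) => v [v1 irr].
  apply: small_periods_zero_one => // e e0.
  have [a [b ab]] := small_int_combination e0 v1 irr.
  exists (a%:~R * v ord0 ord0 + b%:~R * v (lift ord0 ord0) ord0) => // t.
  (* The integer row that takes the combination a v_0 + b v_1. *)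
  pose w : 'rV[int]_n.+2 := \row_j (if j == ord0 then a else if j == lift ord0 ord0 then b else 0).
  have := inv _ (cV_cons (t, v)) (@affine_mx_SLZ n.+2 w 1%:M (det1 _ _)).
  rewrite block_mx_cV_cons map_mx1 mul1mx.
  rewrite mxE !big_ord_recl big1 ?addr0; last first.
    by move=> i _; rewrite !mxE/= mul0r.
  by rewrite !mxE/=.
pose N0 : set (borel_cV R n.+2) := [set v | mu (sl v) = 0%E].
have mN0 : measurable N0.
  have := measurable_fun_ysection mu mcA measurableT (emeasurable_set1 0%E).
  rewrite setTI; congr measurable.
  by apply/seteqP; split=> v /=; rewrite /N0/= slE.
have slg g v : SLZ g -> sl (g *m v) = sl v.
  move=> [M M1 gM]; apply/seteqP; split=> t.
    have := inv _ (cV_cons (t, v)) (@affine_mx_SLZ n.+2 0 M M1).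
    by rewrite block_mx_cV_cons map_mx0 mul0mx mxE addr0 -gM => h; apply h.
  have := inv _ (cV_cons (t, v)) (@affine_mx_SLZ n.+2 0 M M1).
  by rewrite block_mx_cV_cons map_mx0 mul0mx mxE addr0 -gM => h; apply h.
have invN0 g : SLZ g -> [set g *m x | x in (N0 : set 'cV[R]_n.+2)] = N0.
  move=> Sg; apply/seteqP; split=> [_ [v Nv <-]|v Nv].
    by rewrite /N0/= slg.
  exists (invmx g *m v); last by rewrite mulKVmx// unitmx_SLZ.
  by rewrite /N0/= slg//; exact: SLZV.
have ae_of_null (B : set (borel_cV R n.+2)) : measurable B ->
    lebesgue_cV R n.+2 B = 0%E -> {ae lebesgue_cV R n.+2, forall v, ~ B v}.
  by move=> mB B0; exists B; split=> // v /= /contrapT.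
have [N00|N01] := ergS N0 mN0 invN0; [right|left].
  apply/lebesgue_cV_null_slices; first exact: measurableC.
  apply: filterS2 (ae_of_null _ mN0 N00) sl01 => v nN [//|h]; exact: h.
apply/lebesgue_cV_null_slices => //.
by apply: filterS (ae_of_null _ (measurableC mN0) N01) => v /contrapT.
Qed.

(** SL(n + 1, Z) contains the affine group over SL(n, Z). *)
Lemma SLZ_ergodic (n : nat) : ergodic (@SLZ R n.+2).
Proof.
elim: n => [|n IH]; first exact: SL2Z_ergodic.
by apply: ergodic_sub (affine_SLZ_ergodic IH) => g [].
Qed.

End ergodicity.

Theorem theoremA (R : realType) (n : nat) (hn : (3 <= n)%N) :
  exists G : set 'M[R]_n,
    [/\ is_subgroup_SL G, countable G, discrete_subset G,
        ergodic G & ~ ergodic (dual_group G)].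
Proof.
case: n hn => [|[|[|n]]]// _; exists (@affine_SLZ R n.+2); split.
- exact: affine_SLZ_subgroup.
- exact: countable_affine_SLZ.
- exact: discrete_affine_SLZ.
- by apply: affine_SLZ_ergodic; exact: SLZ_ergodic.
- exact: dual_affine_SLZ_not_ergodic.
Qed.
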